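(* Let $S$ be a tropical diagonal Hopf manifold of dimension $d$. Then $$H_{p,q}(S)\cong\begin{cases}\mathbb{R}&\text{if }(p,q)\in\{(0,0),(0,1),(d,d-1),(d,d)\},\\0&\text{otherwise.}\end{cases}$$
   Context: $\mathbb{T}=\mathbb{R}\cup\{\infty\}$, with the topology generated by Euclidean open sets and the sets $(a,\infty]$; $\infty$ also denotes $(\infty,\dots,\infty)\in\mathbb{T}^d$. A tropical diagonal Hopf manifold of dimension $d$ is the quotient $S=(\mathbb{T}^d\setminus\{\infty\})/\langle F\rangle$, where $F$ is translation by a vector $a$ with strictly positive entries. A point of $\mathbb{T}^d$ has sedentarity $I\subseteq\{1,\dots,d\}$ if its infinite coordinates are exactly those in $I$; the set of these is $\mathbb{R}^d_I$ and $\mathbb{T}^d_I$ is its closure. The stratification of $\mathbb{T}^d$ by sedentarity induces a stratification of $S$: for $I\ne\{1,\dots,d\}$ there is a closed face $\tau_I=(\mathbb{T}^d_I\setminus\{\infty\})/\langle F\rangle$ of dimension $d-|I|$ (with open stratum the image of $\mathbb{R}^d_I$), and $\tau_I\subseteq\tau_{I'}$ iff $I'\subseteq I$. The $p$-multi-tangent space of $S$ at (the open stratum of) $\tau_I$ is $\mathcal{F}_p(\tau_I)=\Lambda^p(\mathbb{R}^d/\langle e_i:i\in I\rangle)$, canonically $\Lambda^p(\mathbb{R}^d_I)$, and for $I'\subseteq I$ the map $\mathcal{F}_p(\tau_{I'})\to\mathcal{F}_p(\tau_I)$ is induced by the natural projection. The tropical homology group $H_{p,q}(S)$ is the $q$-th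 homology (with real coefficients) of the complex of singular (or cellular) chains of $S$ compatible with the stratification — each simplex, and each of its faces, has its relative interior in a single open stratum — with a $q$-simplex carrying a coefficient in $\mathcal{F}_p$ of the stratum containing its relative interior, and with the usual boundary map composed on coefficients with the maps $\mathcal{F}_p(\tau_{I'})\to\mathcal{F}_p(\tau_I)$ (for $I'\subseteq I$) induced by the natural projections $\mathbb{R}^d/\langle e_i:i\in I'\rangle\to\mathbb{R}^d/\langle e_i:i\in I\rangle$. *)

(* Defs.v *)
From HB Require Import structures.
From mathcomp Require Import all_boot all_order all_algebra.
From mathcomp Require Import generic_quotient ring_quotient.
From mathcomp Require Import all_classical reals topology normedtype ring.
Import Order.TTheory GRing.Theory Num.Theory numFieldNormedType.Exports.
Set Implicit Arguments.
Unset Strict Implicit.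
Unset Printing Implicit Defensive.
Local Open Scope classical_set_scope.
Local Open Scope ring_scope.

Section Span.
Variables (R : nzRingType) (V : lmodType R).

Definition submod_set : set (set V) :=
  [set W | W 0 /\ forall (a : R) u v, W u -> W v -> W (a *: u + v)].

Definition span (G : set V) : {pred V} := mem (smallest submod_set G).

Fact span_submod_closed G : submod_closed (span G).
Proof.
split=> [|a u v]; rewrite !inE; first by move=> W [[]].
by move=> uG vG W WG; case: (WG) => -[_ WP] _; apply: WP; [exact: uG|exact: vG].
Qed.
HB.instance Definition _ G :=
  GRing.isSubmodClosed.Build R V (span G) (span_submod_closed G).

Lemma mem_span G v : G v -> v \in span G.
Proof. by move=> Gv; rewrite inE; apply: sub_gen_smallest. Qed.

Lemma span_ker G (M : lmodType R) (f : {linear V -> M}) :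
  (forall v, G v -> f v = 0) -> forall v, v \in span G -> f v = 0.
Proof.
move=> fG v; rewrite inE => /(_ [set u | f u = 0]); apply; split=> //.
split=> /= [|a u w fu fw]; first by rewrite linear0.
by rewrite linearP fu fw scaler0 addr0.
Qed.

End Span.

(* [lquot G] is the quotient of V by the submodule spanned by G. *)
Section LmodQuotient.
Variables (R : nzRingType) (V : lmodType R) (G : set V).

Definition lquot : Type := Quotient.quot (span G).
HB.instance Definition _ := GRing.Zmodule.on lquot.

Definition lquot_pi (v : V) : lquot := \pi_(Quotient.quot (span G))%qT v.
Definition lquot_repr (x : lquot) : V := repr (x : Quotient.quot (span G)).

Lemma lquot_reprK : cancel lquot_repr lquot_pi.
Proof. by move=> x; exact: reprK. Qed.

Lemma lquot_eq u v : (lquot_pi u == lquot_pi v) = (u - v \in span G).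
Proof. by rewrite Quotient.idealrBE. Qed.

Lemma lquot_pi_is_zmod_morphism : zmod_morphism lquot_pi.
Proof. exact: (raddfB (\pi_(Quotient.quot (span G))%qT)). Qed.
HB.instance Definition _ :=
  GRing.isZmodMorphism.Build V lquot lquot_pi lquot_pi_is_zmod_morphism.

Definition lquot_scale (a : R) (x : lquot) : lquot :=
  lquot_pi (a *: lquot_repr x).

Lemma lquot_piZ a v : lquot_scale a (lquot_pi v) = lquot_pi (a *: v).
Proof.
apply/eqP; rewrite lquot_eq -scalerBr rpredZ //.
by rewrite -lquot_eq lquot_reprK.
Qed.

Fact lquot_scaleA a b x :
  lquot_scale a (lquot_scale b x) = lquot_scale (a * b) x.
Proof. by rewrite -[x]lquot_reprK !lquot_piZ scalerA. Qed.
Fact lquot_scale1 : left_id 1 lquot_scale.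
Proof. by move=> x; rewrite -[x]lquot_reprK lquot_piZ scale1r. Qed.
Fact lquot_scaleDr : right_distributive lquot_scale +%R.
Proof.
move=> a x y; rewrite -[x]lquot_reprK -[y]lquot_reprK -raddfD !lquot_piZ.
by rewrite scalerDr raddfD.
Qed.
Fact lquot_scaleDl x : {morph lquot_scale^~ x : a b / a + b}.
Proof.
by move=> a b; rewrite -[x]lquot_reprK !lquot_piZ scalerDl raddfD.
Qed.
HB.instance Definition _ := GRing.Zmodule_isLmodule.Build R lquot
  lquot_scaleA lquot_scale1 lquot_scaleDr lquot_scaleDl.

Fact lquot_pi_is_scalable : scalable lquot_pi.
Proof. by move=> a v; rewrite -lquot_piZ. Qed.
HB.instance Definition _ :=
  GRing.isScalable.Build R V lquot *:%R lquot_pi lquot_pi_is_scalable.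

Section Lift.
Variables (M : lmodType R) (f : {linear V -> M}).
Hypothesis fG : forall v, v \in span G -> f v = 0.

Definition lquot_lift of (forall v, v \in span G -> f v = 0) := f \o lquot_repr.

Lemma lquot_liftE v : lquot_lift fG (lquot_pi v) = f v.
Proof.
apply/eqP; rewrite -subr_eq0 -raddfB; apply/eqP/fG.
by rewrite -lquot_eq lquot_reprK.
Qed.

Fact lquot_lift_is_linear : linear (lquot_lift fG).
Proof.
move=> a x y; rewrite -[x]lquot_reprK -[y]lquot_reprK -linearP !lquot_liftE.
exact: linearP.
Qed.
HB.instance Definition _ :=
  GRing.isLinear.Build R lquot M *:%R (lquot_lift fG) lquot_lift_is_linear.
End Lift.

End LmodQuotient.

(* The external direct sum of a family of modules: families of finite support. *)
Section DirectSum.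
Variables (R : nzRingType) (I : choiceType) (M : I -> lmodType R).

Record dsum := DSum {
  dsum_val :> forall i, M i;
  dsum_finite : finite_set [set i | dsum_val i != 0]
}.

Lemma dsumP (f g : dsum) : (forall i, f i = g i) -> f = g.
Proof.
case: f g => [f fP] [g gP] /= fg.
have {}fg : f = g by apply: functional_extensionality_dep.
by case: _ / fg gP => gP; congr DSum; exact: Prop_irrelevance.
Qed.

HB.instance Definition _ := gen_eqMixin dsum.
HB.instance Definition _ := gen_choiceMixin dsum.

Fact dsum0_finite : finite_set [set i | (0 : M i) != 0].
Proof. by rewrite (_ : mkset _ = set0) // -subset0 => i /=; rewrite eqxx. Qed.
Definition dsum0 := @DSum (fun=> 0) dsum0_finite.

Fact dsumN_finite (f : dsum) : finite_set [set i | - f i != 0].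
Proof.
by apply: sub_finite_set (dsum_finite f) => i /=; rewrite oppr_eq0.
Qed.
Definition dsumN f := DSum (dsumN_finite f).

Fact dsumD_finite (f g : dsum) : finite_set [set i | f i + g i != 0].
Proof.
have fgP : finite_set ([set i | f i != 0] `|` [set i | g i != 0]).
  by rewrite finite_setU; split; exact: dsum_finite.
apply: sub_finite_set fgP => i /= fg0; apply/orP; apply: contraR fg0.
by rewrite negb_or !negbK => /andP[/eqP-> /eqP->]; rewrite addr0.
Qed.
Definition dsumD f g := DSum (dsumD_finite f g).

Fact dsumZ_finite (a : R) (f : dsum) : finite_set [set i | a *: f i != 0].
Proof.
apply: sub_finite_set (dsum_finite f) => i /=.
by apply: contraNN => /eqP->; rewrite scaler0.
Qed.
Definition dsumZ a f := DSum (dsumZ_finite a f).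

Fact dsumDA : associative dsumD.
Proof. by move=> f g h; apply: dsumP => i /=; exact: addrA. Qed.
Fact dsumDC : commutative dsumD.
Proof. by move=> f g; apply: dsumP => i /=; exact: addrC. Qed.
Fact dsum0D : left_id dsum0 dsumD.
Proof. by move=> f; apply: dsumP => i /=; exact: add0r. Qed.
Fact dsumND : left_inverse dsum0 dsumN dsumD.
Proof. by move=> f; apply: dsumP => i /=; exact: addNr. Qed.
HB.instance Definition _ :=
  GRing.isZmodule.Build dsum dsumDA dsumDC dsum0D dsumND.

Fact dsumZA a b f : dsumZ a (dsumZ b f) = dsumZ (a * b) f.
Proof. by apply: dsumP => i /=; exact: scalerA. Qed.
Fact dsumZ1 : left_id 1 dsumZ.
Proof. by move=> f; apply: dsumP => i /=; exact: scale1r. Qed.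
Fact dsumZDr : right_distributive dsumZ +%R.
Proof. by move=> a f g; apply: dsumP => i /=; exact: scalerDr. Qed.
Fact dsumZDl f : {morph dsumZ^~ f : a b / a + b}.
Proof. by move=> a b; apply: dsumP => i /=; exact: scalerDl. Qed.
HB.instance Definition _ :=
  GRing.Zmodule_isLmodule.Build R dsum dsumZA dsumZ1 dsumZDr dsumZDl.

Definition dsum_single i (v : M i) j : M j :=
  if pselect (i = j) is left e then ecast k (M k) e v else 0.

Fact dsum_single_finite i v : finite_set [set j | @dsum_single i v j != 0].
Proof.
apply: (@sub_finite_set _ _ [set i]); last exact: finite_set1.
by move=> j /=; rewrite /dsum_single; case: pselect => //=; rewrite eqxx.
Qed.
Definition dsum_in i (v : M i) : dsum := DSum (dsum_single_finite v).

Fact dsum_in_is_linear i : linear (@dsum_in i).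
Proof.
move=> a u v; apply: dsumP => j /=; rewrite /dsum_single.
case: pselect => [e|_]; last by rewrite scaler0 addr0.
by case: _ / e.
Qed.
HB.instance Definition _ i :=
  GRing.isLinear.Build R (M i) dsum *:%R (@dsum_in i) (@dsum_in_is_linear i).

Section Extend.
Variables (N : lmodType R) (phi : forall i, {linear M i -> N}).

Definition dsum_ext (f : dsum) : N := \sum_(i \in [set: I]) phi i (f i).

Lemma dsum_extE (f : dsum) (A : set I) : finite_set A ->
  (forall i, f i != 0 -> A i) -> dsum_ext f = \sum_(i \in A) phi i (f i).
Proof.
move=> finA fA; rewrite /dsum_ext; apply/esym/fsbig_widen => // i [_ /= nAi].
by apply/eqP; apply: contra_notT nAi => fi0; apply: fA;
   apply: contraNN fi0 => /eqP->; rewrite linear0.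
Qed.

Fact dsum_ext_is_linear : linear dsum_ext.
Proof.
move=> a f g; pose A := [set i | f i != 0] `|` [set i | g i != 0].
have finA : finite_set A by rewrite finite_setU; split; exact: dsum_finite.
rewrite (@dsum_extE f A) //; last by move=> i fi; left.
rewrite (@dsum_extE g A) //; last by move=> i gi; right.
rewrite (@dsum_extE _ A) //; last first.
  move=> i /=; apply: contra_neqP => /not_orP[/negP/negPn/eqP-> /negP/negPn/eqP->].
  by rewrite scaler0 addr0.
rewrite !fsbig_finite //= scaler_sumr -big_split /=.
by apply: eq_bigr => i _; exact: linearP.
Qed.
HB.instance Definition _ :=
  GRing.isLinear.Build R dsum N *:%R dsum_ext dsum_ext_is_linear.

Lemma dsum_ext_in i (v : M i) : dsum_ext (dsum_in v) = phi i v.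
Proof.
rewrite (@dsum_extE _ [set i]) //=; last first.
  by move=> j; rewrite /dsum_single; case: pselect => //=; rewrite eqxx.
rewrite fsbig_set1 /dsum_single; case: pselect => // e.
by rewrite (Prop_irrelevance e erefl).
Qed.

End Extend.
End DirectSum.

(* The p-th exterior power of V: the free module on the p-tuples of vectors,
   modulo multilinearity and the vanishing of tuples with a repeated entry. *)
Section ExteriorPower.
Variables (R : nzRingType) (p : nat).
Implicit Types U V W : lmodType R.

Definition tuple_subst (T : Type) (u : {ffun 'I_p -> T}) (i : 'I_p) (x : T) :
  {ffun 'I_p -> T} := [ffun j => if j == i then x else u j].

Definition free_tuples V := dsum (fun _ : {ffun 'I_p -> V} => R^o).
HB.instance Definition _ V := GRing.Lmodule.on (free_tuples V).

Definition free_gen V (u : {ffun 'I_p -> V}) : free_tuples V :=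
  @dsum_in R _ (fun _ : {ffun 'I_p -> V} => R^o) u 1.

Definition ext_rel V : set (free_tuples V) :=
  [set w | (exists u i (a : R) x y,
              w = free_gen (tuple_subst u i (a *: x + y))
                  - a *: free_gen (tuple_subst u i x)
                  - free_gen (tuple_subst u i y))
        \/ (exists (u : {ffun 'I_p -> V}) i j,
              [/\ i != j, u i = u j & w = free_gen u])].

Definition ext V := lquot (@ext_rel V).
HB.instance Definition _ V := GRing.Lmodule.on (ext V).

Definition wedge V (u : {ffun 'I_p -> V}) : ext V := lquot_pi _ (free_gen u).

Lemma wedge_linear V u i (a : R) (x y : V) :
  wedge (tuple_subst u i (a *: x + y)) =
  a *: wedge (tuple_subst u i x) + wedge (tuple_subst u i y).
Proof.
rewrite /wedge -linearP; apply/eqP; rewrite lquot_eq opprD addrA.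
by apply: mem_span; left; exists u, i, a, x, y.
Qed.

Lemma wedge_alt V (u : {ffun 'I_p -> V}) i j :
  i != j -> u i = u j -> wedge u = 0.
Proof.
move=> ij uij; rewrite /wedge -(linear0 (lquot_pi (@ext_rel V))); apply/eqP.
by rewrite lquot_eq subr0; apply: mem_span; right; exists u, i, j.
Qed.

Definition scale_by V (v : V) (a : R^o) : V := a *: v.
Fact scale_by_is_linear V (v : V) : linear (scale_by v).
Proof. by move=> a b c; rewrite /scale_by scalerDl scalerA. Qed.
HB.instance Definition _ V (v : V) :=
  GRing.isLinear.Build R R^o V *:%R (scale_by v) (@scale_by_is_linear V v).

Section Map.
Variables (V W : lmodType R) (f : {linear V -> W}).

Definition free_tuples_map : free_tuples V -> ext W :=
  dsum_ext (fun u : {ffun 'I_p -> V} => scale_by (wedge [ffun i => f (u i)])).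
Fact free_tuples_map_is_linear : linear free_tuples_map.
Proof. exact: linearP. Qed.
HB.instance Definition _ := GRing.isLinear.Build R (free_tuples V) (ext W) *:%R
  free_tuples_map free_tuples_map_is_linear.

Lemma free_tuples_mapE u :
  free_tuples_map (free_gen u) = wedge [ffun i => f (u i)].
Proof. by rewrite [LHS]dsum_ext_in /= /scale_by scale1r. Qed.

Fact free_tuples_map_rel w : w \in span (@ext_rel V) -> free_tuples_map w = 0.
Proof.
move: w; apply: span_ker => w [[u [i [a [x [y ->]]]]]|[u [i [j [ij uij ->]]]]].
  have substE z : [ffun j => f (tuple_subst u i z j)] =
      tuple_subst [ffun j => f (u j)] i (f z).
    by apply/ffunP => j; rewrite !ffunE; case: ifP.
  rewrite !linearB linearZ_LR /= !free_tuples_mapE !substE linearP.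
  rewrite wedge_linear.
  by rewrite addrAC addrK subrr.
by rewrite /= free_tuples_mapE (@wedge_alt _ _ i j) // !ffunE uij.
Qed.

Definition ext_map : ext V -> ext W := lquot_lift free_tuples_map_rel.
Fact ext_map_is_linear : linear ext_map.
Proof. exact: linearP. Qed.
HB.instance Definition _ :=
  GRing.isLinear.Build R (ext V) (ext W) *:%R ext_map ext_map_is_linear.

Lemma ext_mapE u : ext_map (wedge u) = wedge [ffun i => f (u i)].
Proof. by rewrite [LHS]lquot_liftE /= free_tuples_mapE. Qed.

End Map.
End ExteriorPower.

Section Homology.
Variables (R : nzRingType) (A B C : lmodType R).
Variables (f : {linear A -> B}) (g : {linear B -> C}).

Definition cycle : {pred B} := fun x => g x == 0.

Fact cycle_submod_closed : submod_closed cycle.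
Proof.
split=> [|a u v]; rewrite !unfold_in; first by rewrite linear0.
by move=> /eqP gu /eqP gv; rewrite linearP gu gv scaler0 addr0.
Qed.
HB.instance Definition _ :=
  GRing.isSubmodClosed.Build R B cycle cycle_submod_closed.

Record cycles := Cycle { cycle_val : B; _ : cycle_val \in cycle }.
HB.instance Definition _ := [isSub for cycle_val].
HB.instance Definition _ := [Choice of cycles by <:].
HB.instance Definition _ := [SubChoice_isSubLmodule of cycles by <:].

Definition boundaries : set cycles := [set z | exists x, f x = cycle_val z].

(* When g \o f = 0, every [f x] is a cycle and this is ker g / im f. *)
Definition homology := lquot boundaries.
HB.instance Definition _ := GRing.Lmodule.on homology.

End Homology.

Definition lmod_iso (R : nzRingType) (U V : lmodType R) : Prop :=
  exists f : {linear U -> V}, bijective f.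

Section Cosheaf.
Variables (R : nzRingType) (d : nat).
Implicit Types I J K : {set 'I_d}.

Definition axes I : set 'rV[R]_d := [set e | exists2 i, i \in I & e = delta_mx 0 i].

Definition tangent I : lmodType R := lquot (axes I).

Section Proj.
Variables (I J : {set 'I_d}) (IJ : I \subset J).

Fact tangent_pi_rel v :
  v \in span (axes I) -> (lquot_pi (axes J) v : tangent J) = 0.
Proof.
move: v; apply: span_ker => _ [i iI ->].
rewrite -(linear0 (lquot_pi _)); apply/eqP; rewrite lquot_eq subr0.
by apply: mem_span; exists i => //; exact: (fintype.subsetP IJ).
Qed.

Definition tangent_proj : tangent I -> tangent J := lquot_lift tangent_pi_rel.
Fact tangent_proj_is_linear : linear tangent_proj.
Proof. exact: linearP. Qed.
HB.instance Definition _ := GRing.isLinear.Build R (tangent I) (tangent J) *:%R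
  tangent_proj tangent_proj_is_linear.

End Proj.

Variable p : nat.

Definition multitangent I : lmodType R := ext p (tangent I).

Definition multitangent_proj I J (IJ : I \subset J) :
  multitangent I -> multitangent J := ext_map (tangent_proj IJ).
Fact multitangent_proj_is_linear I J IJ : linear (@multitangent_proj I J IJ).
Proof. exact: linearP. Qed.
HB.instance Definition _ I J IJ :=
  GRing.isLinear.Build R (multitangent I) (multitangent J) *:%R
    (@multitangent_proj I J IJ) (@multitangent_proj_is_linear I J IJ).

End Cosheaf.

(* [None] stands for the point at infinity. *)
Definition trop (R : realType) : Type := option R.

Section TropicalLine.
Variable R : realType.

HB.instance Definition _ := Choice.on (trop R).

Definition trop_subbase : set (set (trop R)) :=
  [set U | (exists2 V : set R, open V & U = Some @` V)
        \/ (exists a : R, U = [set x | if x is Some r then a < r else True])].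

HB.instance Definition _ := isSubBaseTopological.Build (trop R) trop_subbase id.

Lemma trop_subbase_open U : trop_subbase U -> open U.
Proof.
move=> UP; exists [set U]; last by rewrite bigcup_set1.
by move=> _ ->; exact: (@finI_from1 _ _ _ id).
Qed.

Lemma trop_finite_open : open [set x : trop R | x != None].
Proof.
apply: trop_subbase_open; left; exists setT; first exact: openT.
by apply/seteqP; split=> [[r|]//= _|_ [r _ <-]//]; exists r.
Qed.

Definition trop_shift (n : nat) (v : 'rV[R]_n) (x : 'rV[trop R]_n) :
  'rV[trop R]_n := \row_i omap (fun r => r + v 0 i) (x 0 i).

End TropicalLine.

Definition punctured (R : realType) d : set 'rV[trop R]_d :=
  [set x | x != const_mx None].
Arguments punctured R d : clear implicits.

Section Hopf.
Variables (R : realType) (d : nat) (a : 'rV[R]_d).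


(* The orbit relation of the group generated by the translation by a. *)
Definition hopf_equiv : rel (punctured R d) :=
  fun x y => `[< exists n : int, \val y = trop_shift (a *~ n) (\val x) >].

Fact hopf_equiv_is_equiv : equiv_class_of hopf_equiv.
Proof.
have shift0 (x : 'rV[trop R]_d) : trop_shift 0 x = x.
  by apply/rowP => i; rewrite !mxE; case: (x 0 i) => //= r; rewrite addr0.
have shiftD u v (x : 'rV[trop R]_d) :
    trop_shift v (trop_shift u x) = trop_shift (u + v) x.
  by apply/rowP => i; rewrite !mxE; case: (x 0 i) => //= r; rewrite ?mxE addrA.
have sym x y : hopf_equiv x y -> hopf_equiv y x.
  move=> /asboolP[n xy]; apply/asboolP; exists (- n).
  by rewrite xy shiftD -mulrzDr subrr mulr0z shift0.
split=> [x|x y|y x z].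
- by apply/asboolP; exists 0; rewrite mulr0z shift0.
- by apply/idP/idP; exact: sym.
- move=> /asboolP[m xy] /asboolP[n yz]; apply/asboolP; exists (m + n).
  by rewrite yz xy shiftD mulrzDr.
Qed.
Canonical hopf_equivRel := EquivRelPack hopf_equiv_is_equiv.
Canonical hopf_encModRel := defaultEncModRel hopf_equiv.

Definition hopf : topologicalType := quotient_topology {eq_quot hopf_equiv}%qT.

(* Independent of the representative: see [sedentarity_pi] below. *)
Definition sedentarity (s : hopf) : {set 'I_d} :=
  [set i | (\val (repr s : punctured R d)) 0 i == None].

End Hopf.

Definition std_simplex (R : realType) q : set 'rV[R]_q.+1 :=
  [set t | (forall i, 0 <= t 0 i) /\ \sum_i t 0 i = 1].
Arguments std_simplex R q : clear implicits.

Section StandardSimplex.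
Variable R : realType.


(* The relative interior of the face whose set of vertices is K. *)
Definition open_face q (K : {set 'I_q.+1}) (t : std_simplex R q) : Prop :=
  forall i, (0 < (\val t) 0 i) = (i \in K).

Fact barycenter_subproof q : (const_mx q.+1%:R^-1 : 'rV[R]_q.+1) \in std_simplex R q.
Proof.
rewrite inE; split=> [i|]; first by rewrite mxE invr_ge0.
under eq_bigr do rewrite mxE.
by rewrite sumr_const card_ord -(mulr_natr _^-1) mulVf // pnatr_eq0.
Qed.
Definition barycenter q : std_simplex R q := 
  exist (fun t => t \in std_simplex R q) _ (barycenter_subproof q).

Definition coface_mx q (i : 'I_q.+2) (t : 'rV[R]_q.+1) : 'rV[R]_q.+2 :=
  \row_j oapp (t 0) 0 (unlift i j).

Lemma coface_mx_at q i (t : 'rV[R]_q.+1) : coface_mx i t 0 i = 0.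
Proof. by rewrite mxE unlift_none. Qed.

Lemma coface_mx_lift q i (t : 'rV[R]_q.+1) j : coface_mx i t 0 (lift i j) = t 0 j.
Proof. by rewrite mxE liftK. Qed.

Fact coface_subproof q (i : 'I_q.+2) (t : std_simplex R q) :
  coface_mx i (\val t) \in std_simplex R q.+1.
Proof.
case: t => t /= /set_mem[t0 t1]; rewrite inE; split=> [j|].
  by rewrite mxE; case: unlift => //=.
rewrite (bigD1_ord i) //= coface_mx_at add0r -[RHS]t1.
by apply: eq_bigr => j _; rewrite coface_mx_lift.
Qed.
Definition coface q (i : 'I_q.+2) (t : std_simplex R q) : std_simplex R q.+1 :=
  exist (fun t => t \in std_simplex R q.+1) _ (coface_subproof i t).

Lemma coface_continuous q (i : 'I_q.+2) : continuous (@coface q i).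
Proof.
have val_continuous : continuous (fun t : std_simplex R q => \val t).
  exact: initial_continuous.
apply: continuous_comp_initial => t A /= [P Pt PA].
have t_near k : nbhs t [set u : std_simplex R q | P 0 (lift i k) (\val u 0 k)].
  suff : nbhs (\val t) [set M : 'rV[R]_q.+1 | P 0 (lift i k) (M 0 k)].
    exact: (val_continuous t).
  exists (fun i' k' => if k' == k then P 0 (lift i k) else setT) => [i' k'|M].
    case: eqP => [->|_]; last exact: filterT.
    by rewrite (ord1 i'); have := Pt 0 (lift i k); rewrite coface_mx_lift.
  by move=> /(_ 0 k); rewrite eqxx.
have : nbhs t [set u : std_simplex R q | forall k, P 0 (lift i k) (\val u 0 k)].
  exact: (filter_forall _ t_near).
apply: filterS => u uP; apply: PA => i' j.
rewrite (ord1 i'); case: (unliftP i j) => [k|] ->.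
  by rewrite coface_mx_lift; exact: uP.
rewrite coface_mx_at; have := Pt 0 i; rewrite coface_mx_at; exact: nbhs_singleton.
Qed.

Lemma open_face_coface q (i : 'I_q.+2) (K : {set 'I_q.+1}) t :
  open_face K t -> open_face (lift i @: K) (coface i t).
Proof.
move=> Kt j /=; case: (unliftP i j) => [k|] ->.
  by rewrite coface_mx_lift Kt mem_imset //; exact: lift_inj.
rewrite coface_mx_at ltxx; apply/esym/negP => /imsetP[k _ /eqP].
by rewrite (negPf (neq_lift _ _)).
Qed.

Lemma open_face_barycenter q : open_face [set: 'I_q.+1] (barycenter q).
Proof. by move=> i; rewrite inE mxE invr_gt0 ltr0n. Qed.

End StandardSimplex.

Section SedentarityTheory.
Variables (R : realType) (d : nat) (a : 'rV[R]_d).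

Definition hopf_pi (x : punctured R d) : hopf a :=
  \pi_({eq_quot (@hopf_equiv R d a)})%qT x.

Lemma sedentarity_pi x :
  sedentarity (hopf_pi x) = [set i | (\val x) 0 i == None]%SET.
Proof.
have : hopf_equiv a x (repr (hopf_pi x)).
  apply/(@eqmodP _ (hopf_equivRel a)).
  by rewrite reprK.
move=> /asboolP[n xE].
by apply/setP => i; rewrite !inE xE mxE; case: (\val x 0 i).
Qed.

Lemma finite_coordinate_open (i : 'I_d) :
  open [set s : hopf a | i \notin sedentarity s].
Proof.
rewrite /open /= /quotient_open.
rewrite (_ : _ @^-1` _ = \val @^-1` [set x : 'rV[trop R]_d | x 0 i != None]).
  exists [set x : 'rV[trop R]_d | x 0 i != None] => //.
  rewrite openE => x /= xi.
  exists (fun _ j => [set r : trop R | j == i -> r != None]) => [k j|y /=].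
    have [->|_] := eqVneq j i; last exact: filterS filterT.
    rewrite (ord1 k); have := trop_finite_open R; rewrite openE => /(_ _ xi).
    by apply: filterS => r rN _.
  by move/(_ 0 i); apply.
by apply/seteqP; split=> x /=; rewrite (sedentarity_pi x) inE.
Qed.

End SedentarityTheory.

Section StratifiedSimplices.
Variables (R : realType) (d : nat) (a : 'rV[R]_d).

Definition admissible q (s : std_simplex R q -> hopf a) : Prop :=
  forall K, exists I, forall t, open_face K t -> sedentarity (s t) = I.

Record simplex q := Simplex {
  simplex_fun :> std_simplex R q -> hopf a;
  simplex_continuous : continuous simplex_fun;
  simplex_admissible : admissible simplex_fun
}.
HB.instance Definition _ q := gen_eqMixin (simplex q).
HB.instance Definition _ q := gen_choiceMixin (simplex q).

Fact face_continuous q (s : simplex q.+1) (i : 'I_q.+2) :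
  continuous (s \o coface i).
Proof.
move=> t; apply: continuous_comp; first exact: coface_continuous.
exact: simplex_continuous.
Qed.

Fact face_admissible q (s : simplex q.+1) (i : 'I_q.+2) :
  admissible (s \o coface i).
Proof.
move=> K; have [I sI] := simplex_admissible s (lift i @: K).
by exists I => t Kt; apply/sI/open_face_coface.
Qed.

Definition face q (s : simplex q.+1) (i : 'I_q.+2) : simplex q :=
  Simplex (@face_continuous q s i) (@face_admissible q s i).

(* The stratum I of the relative interior of s; by [stratumE] the barycenter may
   be replaced by any interior point. *)
Definition stratum q (s : simplex q) : {set 'I_d} :=
  sedentarity (s (barycenter R q)).

Lemma stratumE q (s : simplex q) t :
  open_face [set: 'I_q.+1] t -> sedentarity (s t) = stratum s.
Proof.
move=> t_in; have [I sI] := simplex_admissible s [set: 'I_q.+1]%SET.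
by rewrite /stratum !sI //; exact: open_face_barycenter.
Qed.

Lemma stratum_face q (s : simplex q.+1) i :
  stratum s \subset stratum (face s i).
Proof.
apply/fintype.subsetP => k ks; apply: contraT => kf.
pose y := coface i (barycenter R q); pose z := barycenter R q.+1.
have : nbhs y (s @^-1` [set x | k \notin sedentarity x]).
  have sy : open_nbhs (s y) [set x | k \notin sedentarity x].
    by split; [exact: finite_coordinate_open|].
  exact: (@simplex_continuous _ s y _ (open_nbhs_nbhs sy)).
case=> _ [[W oW <-] /= Wy] WP.
pose g (e : R) := \val y + e *: (\val z - \val y) : 'rV[R]_q.+2.
have : g e @[e --> 0^'+] --> \val y.
  rewrite -[X in _ --> X]addr0 -(scale0r (\val z - \val y)).
  apply: cvgD; first exact: cvg_cst.
  by apply: cvgZr_tmp; apply: cvg_at_right_filter; exact: cvg_id.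
move=> /(_ W (open_nbhs_nbhs (conj oW Wy))) Wg.
have : \forall e \near 0^'+, [/\ 0 < e, e < 1 & W (g e)].
  by near=> e; split; near: e;
     [exact: nbhs_right_gt|exact: nbhs_right_lt|exact: Wg].
case/filter_ex => e [e0 e1 We].
have gkE j : g e 0 j = (1 - e) * \val y 0 j + e * \val z 0 j.
  by rewrite !mxE; ring.
have ye1 : 0 < 1 - e by rewrite subr_gt0.
have /set_mem[y0 y1] := valP y; have /set_mem[z0 z1] := valP z.
have z_gt0 j : 0 < \val z 0 j by rewrite mxE invr_gt0 ltr0n.
have gE : g e \in std_simplex R q.+1.
  rewrite inE; split=> [j|]; first by rewrite gkE addr_ge0 // mulr_ge0 // ltW.
  under eq_bigr do rewrite gkE.
  by rewrite big_split -!mulr_sumr y1 z1 !mulr1 /= subrK.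
pose u : std_simplex R q.+1 := exist (fun t => t \in std_simplex R q.+1) _ gE.
have /negP[] : k \notin sedentarity (s u) by exact: (WP u).
rewrite stratumE // => j.
by rewrite inE gkE ltr_wpDl ?mulr_ge0 ?mulr_gt0 // ltW.
Unshelve. all: by end_near.
Qed.
Variable p : nat.

Definition chain q : lmodType R :=
  dsum (fun s : simplex q => multitangent R p (stratum s)).

(* The boundary of the simplex s with coefficient v: the alternating sum of the
   faces of s, each with the image of v in the multitangent space of the (more
   sedentary) stratum of that face. *)
Definition simplex_bd q (s : simplex q.+1) (v : multitangent R p (stratum s)) :
    chain q :=
  \sum_(i < q.+2) (-1) ^+ i *:
    dsum_in (M := fun t => multitangent R p (stratum t)) (i := face s i)
      (multitangent_proj (stratum_face s i) v).

Fact simplex_bd_is_linear q (s : simplex q.+1) : linear (@simplex_bd q s).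
Proof.
move=> c u v; rewrite /simplex_bd scaler_sumr -big_split /=.
apply: eq_bigr => i _; rewrite linearP /= linearP /= scalerDr !scalerA.
by rewrite mulrC.
Qed.
HB.instance Definition _ q (s : simplex q.+1) :=
  GRing.isLinear.Build R (multitangent R p (stratum s)) (chain q) *:%R
    (@simplex_bd q s) (@simplex_bd_is_linear q s).

(* On 0-chains, [bd] is the zero map. *)
Definition bd q : chain q -> chain q.-1 :=
  match q with
  | 0 => \0
  | q'.+1 => dsum_ext (@simplex_bd q')
  end.

Fact bd_is_linear q : linear (@bd q).
Proof. by case: q => [|q]; exact: linearP. Qed.
HB.instance Definition _ q :=
  GRing.isLinear.Build R (chain q) (chain q.-1) *:%R (@bd q) (@bd_is_linear q).

(* H_{p,q} of the Hopf manifold [hopf a]. *)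
Definition tropical_homology q : lmodType R := homology (@bd q.+1) (@bd q).

End StratifiedSimplices.

(* Main.v *)
Require Import Defs.
From HB Require Import structures.
From mathcomp Require Import all_boot all_order all_algebra finmap fingroup perm.
From mathcomp Require Import all_classical reals topology normedtype sequences exp.
From mathcomp Require Import generic_quotient ring lra zify.
Import Order.TTheory GRing.Theory Num.Theory.
Import numFieldNormedType.Exports.
Set Implicit Arguments.
Unset Strict Implicit.
Unset Printing Implicit Defensive.
Local Open Scope classical_set_scope.
Local Open Scope ring_scope.

(** In the coordinates w_i = exp(- x_i / a_i), with w_i = 0 at infinity, the
    punctured tropical space becomes the orthant X of the nonzero vectors with
    nonnegative entries, the translation by a becomes the scaling by 1/e, and
    the sedentarity of a point is the set of its vanishing coordinates.  So S is
    the quotient of the convex set X by the scalings by powers of e.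

    Coefficients.  The cosheaf of p-multi-tangent spaces splits into cosheaves of
    rank one indexed by the sets J of p indices: the one of J is spanned by the
    wedge of the basis vectors e_j with j in J, its coordinate is the p x p minor
    on the columns in J, and it lives exactly on the strata I disjoint from J.
    Hence H_(p,q)(S) is the sum over J of the homology of S relative to the union
    of the facets x_j = infinity with j in J ([tropical_homology0],
    [tropical_homology_line]).  Splitting the sum over sets is avoided by summing
    over all maps f from p to the indices: the injective ones count every J
    exactly p! times, the others contribute nothing ([sum_minor]).  More generally one considers the chains on the strata I with
    L <= I and I disjoint from J ([between]).

    Upstairs.  Suppose that L and J do not cover all the indices.  The 0/1 vector
    supported outside of L and J is then a point of X, and by convexity every
    simplex of X can be coned off to it.  The cone on a simplex of stratum I has
    stratum I n (L u J), which is admissible for (L, J) as soon as I is, and the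
    apex itself has stratum L u J, which is admissible only when J is empty.  So
    the chains of X are acyclic when J is not empty, and resolve the scalars when
    J is empty ([orthant_acyclic_at], [orthant_acyclic_at0],
    [orthant_aug_boundary]).

    Downstairs.  A simplex of S lifts to X, uniquely up to a power of e
    ([oproj_surj], [oproj_fiber]).  So the chains of S are the coinvariants of
    the chains of X under a free action of the integers: acyclicity descends, and
    a resolution of the scalars turns into the homology of a circle, a line in
    degrees 0 and 1 ([hopf_acyclic_at], [hopf_line_at]).

    Corner.  When L and J are complementary there is no apex.  Taking j out of J
    yields a short exact sequence of complexes of S

      0 -> (L + j, J - j) -> (L, J - j) -> (L, J) -> 0

    with acyclic middle term, so that the homology moves up by one degree at each
    step ([hopf_corner]).  The sequence is exact on the nose, with no subdivision,
    since the interior of a simplex lies in a single stratum.  The induction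
    starts from J = {j}, which gives the same chains as J empty because no point
    has full sedentarity, and ends with a line in degrees #|J| - 1 and #|J|.

    For L empty, J empty gives the classes in bidegrees (0,0) and (0,1), J full
    those in bidegrees (d,d-1) and (d,d), and every other J gives nothing. *)

(** * Free chains on stratified semi-simplicial sets *)

Section FreeModule.
Variables (K : nzRingType) (T : choiceType).

Definition free : lmodType K := dsum (fun _ : T => K^o).

Definition single (s : T) : free := @dsum_in K T (fun _ : T => K^o) s 1.

(** Evaluation with values in K itself: the entries of a finitely supported
    family have the regular module K^o as their type. *)
Definition coef (c : free) (s : T) : K := c s.

Lemma coef_single s t : coef (single s) t = (s == t)%:R.
Proof.
rewrite /coef /= /dsum_single; case: pselect => [e|/eqP/negPf->//].
by case: _ / e; rewrite eqxx.
Qed.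

Lemma coef0 s : coef 0 s = 0. Proof. by []. Qed.
Lemma coefD c e s : coef (c + e) s = coef c s + coef e s. Proof. by []. Qed.
Lemma coefZ (k : K) c s : coef (k *: c) s = k * coef c s. Proof. by []. Qed.

Lemma coefP c e : (forall s, coef c s = coef e s) -> c = e.
Proof. by move=> ce; apply: dsumP => s; exact: ce. Qed.

Section Extension.
Variables (V : lmodType K) (u : T -> V).

(** Opaque, so that rewriting with linearity never unfolds it into the sum
    that defines it. *)
Fact free_ext_subproof :
  {f : {linear free -> V} | forall s, f (single s) = u s}.
Proof.
exists (dsum_ext (fun s : T => scale_by (u s)) : {linear free -> V}) => s.
by rewrite [LHS]dsum_ext_in /= /scale_by scale1r.
Qed.

Definition free_ext : {linear free -> V} := sval free_ext_subproof.

Lemma free_ext_single s : free_ext (single s) = u s.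
Proof. exact: svalP free_ext_subproof s. Qed.
End Extension.

End FreeModule.

Section DirectSumInduction.
Variables (K : nzRingType) (I : choiceType) (M : I -> lmodType K).

Lemma dsum_decomp (c : dsum M) :
  c = \sum_(i \in [set i | c i != 0]) dsum_in (c i).
Proof.
have fin := dsum_finite c.
have evalD j : {morph (fun e : dsum M => e j) : x y / x + y} by [].
apply: dsumP => j; rewrite fsbig_finite //=.
rewrite (big_morph (fun e : dsum M => e j) (evalD j) (erefl _)).
rewrite /= /dsum_single.
have [cj|/eqP cj] := eqVneq (c j) 0.
  rewrite big1 // => i _; case: pselect => // e; case: _ / e cj => cj.
  by rewrite cj.
have jin : j \in fset_set [set i | c i != 0].
  by rewrite in_fset_set // mem_set //=; apply/eqP.
rewrite (big_fsetD1 j) //= big1_seq ?addr0; last first.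
  move=> i /andP[_ /finmap.fsetD1P[/eqP ij _]]; case: pselect => // e.
by case: pselect => // e; rewrite (Prop_irrelevance e erefl).
Qed.

Lemma dsum_ind (P : dsum M -> Prop) : P 0 ->
  (forall x y, P x -> P y -> P (x + y)) ->
  (forall i v, P (dsum_in (i := i) v)) -> forall c, P c.
Proof.
move=> P0 PD Pin c; rewrite (dsum_decomp c) fsbig_finite; last exact: dsum_finite.
exact: big_ind.
Qed.

End DirectSumInduction.

(** The analogue of [dsum_ind] for generators instead of multiples of them. *)
Lemma free_ind (K : nzRingType) (T : choiceType) (P : free K T -> Prop) :
  P 0 -> (forall x y, P x -> P y -> P (x + y)) ->
  (forall (k : K) x, P x -> P (k *: x)) ->
  (forall s, P (single K s)) -> forall c, P c.
Proof.
move=> P0 PD PZ Ps; apply: dsum_ind => // s k.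
suff -> : dsum_in (M := fun _ : T => K^o) (i := s) k = k *: single K s by exact/PZ/Ps.
by rewrite -linearZ /= [k%:A]mulr1.
Qed.

Lemma eq_free_linear (K : nzRingType) (T : choiceType) (V : lmodType K)
    (f g : {linear free K T -> V}) :
  (forall s, f (single K s) = g (single K s)) -> f =1 g.
Proof.
move=> fg; apply: free_ind => [|x y fx fy|k x fx|//]; first by rewrite !linear0.
  by rewrite !linearD fx fy.
by rewrite !linearZ /= fx.
Qed.

(** Semi-simplicial sets whose cells carry a stratum that can only grow on
    faces.  Both S and its cover X give one. *)
Record faceSystem (d : nat) := FaceSystem {
  cell :> nat -> choiceType;
  facet : forall q, cell q.+1 -> 'I_q.+2 -> cell q;
  strat : forall q, cell q -> {set 'I_d};
  facet_facet : forall q (s : cell q.+2) (i j : 'I_q.+2), (i <= j)%N ->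
    facet (facet s (lift ord0 j)) i = facet (facet s (inord i)) j;
  strat_facet : forall q (s : cell q.+1) i, strat s \subset strat (facet s i);
  strat_proper : forall q (s : cell q), strat s != [set: 'I_d]%SET
}.

Section Chains.
Variables (K : fieldType) (d : nat) (X : faceSystem d).
Implicit Types g : pred {set 'I_d}.

Definition fchain q : lmodType K := free K (X q).

(** Zero on 0-chains, so that cycles and boundaries have a uniform definition in
    all degrees. *)
Definition fbd q : {linear fchain q -> fchain q.-1} :=
  match q with
  | 0 => \0
  | q'.+1 => free_ext (fun s : X q'.+1 =>
      \sum_(i < q'.+2) (-1) ^+ i *: single K (facet s i) : fchain q')
  end.

Lemma fbd_single q (s : X q.+1) :
  fbd q.+1 (single K s) = \sum_(i < q.+2) (-1) ^+ i *: single K (facet s i).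
Proof. exact: free_ext_single. Qed.

(** Chain complexes attached to a set of strata g are not formed as subquotients:
    they are the chains fixed by this projector, with boundary [restr g] after
    [fbd]. *)
Definition restr g q : {linear fchain q -> fchain q} :=
  free_ext (fun s : X q => (g (strat s))%:R *: single K s : fchain q).

(* Linearity is restated for each operator: unification on the generic lemmas
   unfolds the extension of a map on generators. *)
Lemma restr0 g q : restr g q 0 = 0. Proof. exact: linear0. Qed.
Lemma restrB g q x y : restr g q (x - y) = restr g q x - restr g q y.
Proof. exact: linearB. Qed.
Lemma restrD g q x y : restr g q (x + y) = restr g q x + restr g q y.
Proof. exact: linearD. Qed.
Lemma restrZ g q k x : restr g q (k *: x) = k *: restr g q x.
Proof. exact: linearZ. Qed.
Lemma restr_sum g q n (F : 'I_n -> fchain q) :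
  restr g q (\sum_i F i) = \sum_i restr g q (F i).
Proof. exact: linear_sum. Qed.
Lemma fbd0 q : fbd q 0 = 0. Proof. exact: linear0. Qed.
Lemma fbdB q x y : fbd q (x - y) = fbd q x - fbd q y.
Proof. exact: linearB. Qed.
Lemma fbdD q x y : fbd q (x + y) = fbd q x + fbd q y.
Proof. exact: linearD. Qed.
Lemma fbdZ q k x : fbd q (k *: x) = k *: fbd q x.
Proof. exact: linearZ. Qed.
Lemma fbd_sum q n (F : 'I_n -> fchain q) :
  fbd q (\sum_i F i) = \sum_i fbd q (F i).
Proof. exact: linear_sum. Qed.

Lemma restr_single g q (s : X q) : restr g q (single K s) = (g (strat s))%:R *: single K s.
Proof. exact: free_ext_single. Qed.

Lemma coef_restr g q (c : fchain q) s : coef (restr g q c) s = (g (strat s))%:R * coef c s.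
Proof.
elim/free_ind: c => [|x y IHx IHy|k x IHx|t]; first by rewrite linear0 !coef0 mulr0.
- by rewrite linearD !coefD IHx IHy mulrDr.
- by rewrite linearZ_LR !coefZ IHx mulrCA.
- rewrite restr_single coefZ coef_single.
  by have [->|_] := eqVneq t s; rewrite ?mulr0.
Qed.

Lemma restr_restr g h q c : restr g q (restr h q c) = restr (predI g h) q c.
Proof. by apply: coefP => s; rewrite !coef_restr mulrA -natrM mulnb. Qed.

Lemma eq_restr g h q : (forall s : X q, g (strat s) = h (strat s)) -> restr g q =1 restr h q.
Proof. by move=> gh c; apply: coefP => s; rewrite !coef_restr gh. Qed.

End Chains.

Arguments fbd {K d X} q : simpl never.
Arguments restr {K d X} g q : simpl never.

Section Boundary.
Variables (K : fieldType) (d : nat) (X : faceSystem d).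
Implicit Types g : pred {set 'I_d}.
Local Notation fchain := (fchain K X).
Local Notation fbd := (@fbd K d X).
Local Notation restr := (@restr K d X).

(** The n+2 faces of a cell, seen from its face number j: those numbered at most
    j, and the successors of those numbered at least j. *)
Lemma sum_ord_split (V : zmodType) n (j : 'I_n.+1) (Y : 'I_n.+2 -> V) :
  \sum_i Y i = \sum_(i < n.+1 | (i <= j)%N) Y (inord i)
             + \sum_(i < n.+1 | (j <= i)%N) Y (lift ord0 i).
Proof.
have -> : \sum_i Y i = \sum_(0 <= i < n.+2) Y (inord i).
  by rewrite big_mkord; apply: eq_bigr => i _; rewrite inord_val.
rewrite (big_cat_nat (n := j.+1)) //=; last by rewrite ltnS ltnW.
congr (_ + _).
  rewrite big_mkord (big_ord_widen_cond n.+1 xpredT (fun i => Y (inord i))) //=.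
transitivity (\sum_(0 <= i < n.+1 | (j <= i)%N) Y (inord i.+1)).
  rewrite big_add1 /= [RHS](big_cat_nat (n := j)) //=; last exact: ltnW.
  rewrite [X in _ = X + _]big1_seq ?add0r; last first.
    by move=> i; rewrite mem_index_iota => /andP[ji /andP[_]]; rewrite ltnNge ji.
  rewrite big_nat_cond [RHS]big_nat_cond; apply: eq_bigl => i.
  by rewrite andbT; case: (j <= i)%N; rewrite ?andbF ?andbT.
rewrite big_mkord; apply: eq_bigr => i _; congr Y; apply: val_inj.
by rewrite /= inordK // ltnS.
Qed.

(** Splitting the inner sum by [sum_ord_split] makes the two halves opposite
    after exchanging the roles of i and j, by [facet_facet]. *)
Lemma fbd_fbd q c : fbd q (fbd q.+1 c) = 0.
Proof.
case: q c => [//|q].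
have /= := @eq_free_linear K (X q.+2) (fchain q) (fbd q.+1 \o fbd q.+2) \0.
apply=> s; rewrite fbd_single linear_sum /=.
under eq_bigr do rewrite linearZ_LR fbd_single /= scaler_sumr.
rewrite exchange_big /=.
under eq_bigr => j _ do rewrite (sum_ord_split j) /=.
rewrite big_split /= addrC.
rewrite (exchange_big_dep xpredT) //= -big_split /= big1 // => i _.
rewrite -big_split /= big1 // => j ij.
rewrite facet_facet // !scalerA -!exprD inordK; last by rewrite ltnS ltnW.
by rewrite /bump /= add1n addSn exprS mulN1r scaleNr addnC addNr.
Qed.

Lemma restr_fbd_single g q (s : X q.+1) :
  restr g q (fbd q.+1 (single K s)) =
  \sum_(i < q.+2) (-1) ^+ i *: ((g (strat (facet s i)))%:R *: single K (facet s i)).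
Proof.
rewrite fbd_single linear_sum /=; apply: eq_bigr => i _.
by rewrite linearZ_LR restr_single.
Qed.

Lemma restr_id g q c : restr g q (restr g q c) = restr g q c.
Proof. by rewrite restr_restr; apply: eq_restr => s /=; rewrite andbb. Qed.

(** g1 spans a subcomplex: the faces of its cells never fall into g2. *)
Lemma restr_fbd_restr0 g1 g2 q c :
  (forall I J : {set 'I_d}, I \subset J -> g1 I -> ~~ g2 J) ->
  restr g2 q.-1 (fbd q (restr g1 q c)) = 0.
Proof.
move=> g12; case: q c => [|q] c; first by rewrite linear0.
have /= := @eq_free_linear K (X q.+1) (fchain q)
  (restr g2 q \o fbd q.+1 \o restr g1 q.+1) \0.
apply=> s; rewrite restr_single linearZ_LR /=; case g1s : (g1 (strat s)); last first.
  by rewrite scale0r linear0.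
rewrite scale1r restr_fbd_single big1 // => i _.
by rewrite (negPf (g12 _ _ (strat_facet s i) g1s)) scale0r scaler0.
Qed.

Definition is_cycle g q (c : fchain q) : Prop :=
  restr g q c = c /\ restr g q.-1 (fbd q c) = 0.

Definition is_boundary g q (c : fchain q) : Prop :=
  exists y : fchain q.+1, restr g q.+1 y = y /\ restr g q (fbd q.+1 y) = c.

Definition acyclic_at g q := forall c : fchain q, is_cycle g c -> is_boundary g c.

(** One-dimensional homology, without forming the quotient: a generator that is
    not a boundary. *)
Definition line_at g q := exists z : fchain q, [/\ is_cycle g z, ~ is_boundary g z &
  forall c : fchain q, is_cycle g c -> exists k : K, is_boundary g (c - k *: z)].

(** The condition under which [restr g] after [fbd] squares to zero: faces of
    faces that come back to g have not left it in between. *)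
Definition convex g := forall I J L : {set 'I_d},
  I \subset J -> J \subset L -> g I -> g L -> g J.

Lemma restr_fbd_fbd g q (c : fchain q.+1) : convex g -> restr g q.+1 c = c ->
  restr g q.-1 (fbd q (restr g q (fbd q.+1 c))) = 0.
Proof.
move=> gC gc; case: q c gc => [|q] c gc; first by rewrite linear0.
rewrite -gc.
have /= := @eq_free_linear K (X q.+2) (fchain q)
  (restr g q \o fbd q.+1 \o restr g q.+1 \o fbd q.+2 \o restr g q.+2) \0.
apply=> s; rewrite restr_single linearZ_LR /=; case gs : (g (strat s)); last first.
  by rewrite scale0r !linear0.
rewrite scale1r -[RHS](restr0 K X g q) -(fbd_fbd (single K s)).
rewrite restr_fbd_single fbd_single !fbd_sum !restr_sum; apply: eq_bigr => i _.
rewrite !fbdZ !restrZ restr_fbd_single; congr (_ *: _).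
rewrite scaler_sumr; apply: eq_bigr => j _.
case gij : (g (strat (facet (facet s i) j))); last by rewrite scale0r !scaler0.
by rewrite (gC _ _ _ (strat_facet s i) (strat_facet (facet s i) j)) // scale1r.
Qed.

Lemma eq_line_at g h q : (forall r (s : X r), g (strat s) = h (strat s)) ->
  line_at g q -> line_at h q.
Proof.
move=> gh.
have E r c : restr h r c = restr g r c by apply: eq_restr => s; rewrite gh.
case=> z [zc zb zP]; exists z; split.
- by rewrite /is_cycle !E.
- by case=> y; rewrite !E => yP; apply: zb; exists y.
- move=> c; rewrite /is_cycle !E => /zP[k [y yP]].
  by exists k, y; rewrite !E.
Qed.

Lemma eq_acyclic_at g h q : (forall r (s : X r), g (strat s) = h (strat s)) ->
  acyclic_at g q -> acyclic_at h q.
Proof.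
move=> gh.
have E r c : restr h r c = restr g r c by apply: eq_restr => s; rewrite gh.
by move=> gP c; rewrite /is_cycle !E => /gP[y yP]; exists y; rewrite !E.
Qed.

End Boundary.

(** * The exact sequence of a subcomplex with acyclic total complex *)

(** g is the disjoint union of g1, closed under faces, and g2: the complex of g1
    is a subcomplex of that of g, with quotient the complex of g2.  As the middle
    one is acyclic, the connecting map is an isomorphism from the homology of g2
    to that of g1 one degree lower. *)
Section ExactSequence.
Variables (K : fieldType) (d : nat) (X : faceSystem d).
Variables g g1 g2 : pred {set 'I_d}.
Hypothesis gC : convex g.
Hypothesis gE : forall I, g I = g1 I || g2 I.
Hypothesis g12 : forall I J : {set 'I_d}, I \subset J -> g1 I -> ~~ g2 J.
Hypothesis g_acyclic : forall q, acyclic_at K X g q.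
Local Notation restr := (@restr K d X).
Local Notation fbd := (@fbd K d X).

Let restr_split q c : restr g q c = restr g1 q c + restr g2 q c.
Proof.
apply: coefP => s; rewrite coefD !coef_restr gE -mulrDl.
have := @g12 (strat s) (strat s) (subxx _).
by case: (g1 _) => [/(_ isT)/negPf->|_]; rewrite /= ?addr0 ?add0r.
Qed.

Let restr1 q c : restr g1 q c = c -> restr g q c = c.
Proof.
move=> g1c; rewrite -g1c restr_restr; apply: eq_restr => s /=; rewrite gE.
by case: (g1 _); rewrite ?andbF.
Qed.
Let restr2 q c : restr g2 q c = c -> restr g q c = c.
Proof.
move=> g2c; rewrite -g2c restr_restr; apply: eq_restr => s /=; rewrite gE.
by case: (g2 _); rewrite ?andbF ?orbT.
Qed.
Let restr2g q c : restr g2 q (restr g q c) = restr g2 q c.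
Proof.
rewrite restr_restr; apply: eq_restr => s /=.
by rewrite gE; case: (g2 _); rewrite ?orbT.
Qed.
Let restr12 q c : restr g2 q (restr g1 q c) = 0.
Proof.
apply: coefP => s; rewrite !coef_restr coef0 mulrA -natrM mulnb.
have := @g12 (strat s) (strat s) (subxx _).
by case: (g1 _) => [/(_ isT)/negPf->|_]; rewrite /= ?andbF ?mul0r.
Qed.
Let fbd1 q c : restr g1 q c = c -> restr g q.-1 (fbd q c) = restr g1 q.-1 (fbd q c).
Proof. by move=> <-; rewrite restr_split [X in _ + X]restr_fbd_restr0 ?addr0. Qed.
Let fbd2 q c : restr g2 q.-1 (fbd q (restr g q c)) = restr g2 q.-1 (fbd q (restr g2 q c)).
Proof. by rewrite (restr_split c) fbdD restrD [X in X + _]restr_fbd_restr0 ?add0r. Qed.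
Let cyc2 q c : is_cycle g2 c -> restr g q.-1 (fbd q c) = restr g1 q.-1 (fbd q c).
Proof. by case=> _ c2; rewrite restr_split c2 addr0. Qed.

(** The connecting map, on cycles. *)
Lemma connecting_cycle q (c : fchain K X q.+1) :
  is_cycle g2 c -> is_cycle g1 (restr g1 q (fbd q.+1 c)).
Proof.
move=> c2; split; first exact: restr_id.
rewrite -(@fbd1 q) ?restr_id // -(cyc2 c2).
apply: restr_fbd_fbd => //; by case: c2 => c2 _; exact: restr2.
Qed.

(** Any cycle of g2 of degree 0 is one of g, hence bounds. *)
Lemma acyclic_at0_quotient : acyclic_at K X g2 0.
Proof.
move=> c c2; have [|y [gy yc]] := @g_acyclic 0 c.
  by split; [case: c2 => c2 _; exact: restr2|exact: linear0].
exists (restr g2 1 y); split; first exact: restr_id.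
have := @fbd2 1 y; rewrite gy /= => <-.
by rewrite -restr2g yc; case: c2.
Qed.

Lemma acyclic_at_quotient q : acyclic_at K X g1 q -> acyclic_at K X g2 q.+1.
Proof.
move=> g1P c c2; have [y [g1y yE]] := g1P _ (connecting_cycle c2).
have [|w [gw wE]] := @g_acyclic q.+1 (c - y).
  split; first by rewrite restrB (restr1 g1y) restr2 //; case: c2.
  by rewrite !(fbdB, restrB) (cyc2 c2) (@fbd1 q.+1) //= yE subrr.
exists (restr g2 _ w); split; first exact: restr_id.
have := @fbd2 q.+2 w; rewrite gw /= => <-.
rewrite -restr2g wE restrB -g1y restr12 subr0.
by case: c2.
Qed.

Lemma line_at_quotient q : line_at K X g1 q -> line_at K X g2 q.+1.
Proof.
case=> z1 [z1c z1b z1P].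
have g1z1 : restr g1 q z1 = z1 by case: z1c.
(* w is a primitive in g of the generator z1 for g1; its g2-part is the
   generator for g2. *)
have [|w [gw wE]] := @g_acyclic q z1.
  by split; [exact: restr1|rewrite fbd1 //; case: z1c].
have wz : restr g2 q (fbd q.+1 (restr g2 _ w)) = 0.
  have := @fbd2 q.+1 w; rewrite gw /= => <-.
  by rewrite -restr2g wE -g1z1 restr12.
exists (restr g2 _ w); split.
- by split; [exact: restr_id|].
- case=> y [g2y yE]; apply: z1b.
  have wy : restr g1 q.+1 (w - restr g1 q.+1 (fbd q.+2 y)) = w - restr g q.+1 (fbd q.+2 y).
    rewrite [in RHS]restr_split yE restrB restr_id -{2}gw restr_split.
    by rewrite opprD [- _ - _]addrC addrA addrK.
  exists (w - restr g _ (fbd q.+2 y)); split; first by rewrite -wy restr_id.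
  rewrite -(@fbd1 q.+1); last by rewrite -wy restr_id.
  by rewrite /= !(fbdB, restrB) wE (restr_fbd_fbd (c := y)) ?subr0 //; exact: restr2.
- move=> c c2; have [k [y [g1y yE]]] := z1P _ (connecting_cycle c2).
  have [|v [gv vE]] := @g_acyclic q.+1 (c - k *: w - y).
    split.
      rewrite !(fbdB, restrB, fbdZ, restrZ) (restr1 g1y) gw restr2 //; by case: c2.
    rewrite !(fbdB, restrB, fbdZ, restrZ) (cyc2 c2) wE (@fbd1 q.+1) //= yE.
    by rewrite subrr.
  exists k, (restr g2 _ v); split; first exact: restr_id.
  have := @fbd2 q.+2 v; rewrite gv /= => <-.
  rewrite -restr2g vE !(fbdB, restrB, fbdZ, restrZ) -g1y restr12 subr0.
  by case: c2 => ->.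
Qed.

End ExactSequence.

(** * Quotients by a free action of the integers *)

Section Augmentation.
Variables (K : fieldType) (d : nat) (X : faceSystem d).

Definition aug : {linear fchain K X 0 -> K^o} := free_ext (fun=> 1 : K^o).

Lemma aug_single s : aug (single K s) = 1. Proof. exact: free_ext_single. Qed.

Lemma aug_fbd (c : fchain K X 1) : aug (fbd 1 c) = 0.
Proof.
have /= := @eq_free_linear K (X 1) K^o (aug \o @fbd K d X 1) \0; apply=> s.
rewrite /= fbd_single big_ord_recl big_ord1 expr0 scale1r expr1 scaleN1r.
by rewrite linearB /= !aug_single subrr.
Qed.

End Augmentation.

Lemma subrACA (V : zmodType) : @interchange V (fun x y => x - y) (fun x y => x - y).
Proof. by move=> x y z t; rewrite !opprB [t - z]addrC addrACA [- y + t]addrC. Qed.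

(** The cells of Y are the orbits of the shift sh on those of X, which acts
    freely.  On chains this is an exact sequence

      0 -> chains of X -> chains of X -> chains of Y -> 0

    whose first map is 1 - sh ([chain_sh_fixed], [chain_pr_ker]), and the lemmas
    below are its consequences in homology. *)
Section Covering.
Variables (K : fieldType) (d : nat) (X Y : faceSystem d).
Variables (pr : forall q, X q -> Y q) (sh : forall q, X q -> X q).
Hypothesis pr_facet : forall q (s : X q.+1) i, pr (facet s i) = facet (pr s) i.
Hypothesis sh_facet : forall q (s : X q.+1) i, sh (facet s i) = facet (sh s) i.
Hypothesis strat_pr : forall q (s : X q), strat (pr s) = strat s.
Hypothesis strat_sh : forall q (s : X q), strat (sh s) = strat s.
Hypothesis pr_surj : forall q (t : Y q), exists s, pr s = t.
Hypothesis pr_sh : forall q (s : X q), pr (sh s) = pr s.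
Hypothesis pr_fiber : forall q (s t : X q), pr s = pr t ->
  exists n, t = iter n (@sh q) s \/ s = iter n (@sh q) t.
Hypothesis sh_free : forall q (s : X q) n, iter n (@sh q) s = s -> n = 0%N.

Definition chain_pr q : {linear fchain K X q -> fchain K Y q} :=
  free_ext (fun s : X q => single K (pr s) : fchain K Y q).
Definition chain_sh q : {linear fchain K X q -> fchain K X q} :=
  free_ext (fun s : X q => single K (sh s) : fchain K X q).

Lemma chain_pr_single q s : chain_pr q (single K s) = single K (pr s).
Proof. exact: free_ext_single. Qed.
Lemma chain_sh_single q s : chain_sh q (single K s) = single K (sh s).
Proof. exact: free_ext_single. Qed.

Lemma chain_prB q x y : chain_pr q (x - y) = chain_pr q x - chain_pr q y.
Proof. exact: linearB. Qed.
Lemma chain_prD q x y : chain_pr q (x + y) = chain_pr q x + chain_pr q y.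
Proof. exact: linearD. Qed.
Lemma chain_prZ q k x : chain_pr q (k *: x) = k *: chain_pr q x.
Proof. exact: linearZ. Qed.
Lemma chain_pr_sum q n (F : 'I_n -> fchain K X q) :
  chain_pr q (\sum_i F i) = \sum_i chain_pr q (F i).
Proof. exact: linear_sum. Qed.
Lemma chain_shB q x y : chain_sh q (x - y) = chain_sh q x - chain_sh q y.
Proof. exact: linearB. Qed.
Lemma chain_shD q x y : chain_sh q (x + y) = chain_sh q x + chain_sh q y.
Proof. exact: linearD. Qed.
Lemma chain_shZ q k x : chain_sh q (k *: x) = k *: chain_sh q x.
Proof. exact: linearZ. Qed.
Lemma chain_sh_sum q n (F : 'I_n -> fchain K X q) :
  chain_sh q (\sum_i F i) = \sum_i chain_sh q (F i).
Proof. exact: linear_sum. Qed.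

Lemma chain_pr_restr (g : pred {set 'I_d}) q (c : fchain K X q) :
  chain_pr q (restr g q c) = restr g q (chain_pr q c).
Proof.
have /= := @eq_free_linear K (X q) (fchain K Y q) (chain_pr q \o restr g q)
  (restr g q \o chain_pr q); apply=> s.
by rewrite /= restr_single chain_pr_single restr_single chain_prZ chain_pr_single strat_pr.
Qed.

Lemma chain_sh_restr (g : pred {set 'I_d}) q (c : fchain K X q) :
  chain_sh q (restr g q c) = restr g q (chain_sh q c).
Proof.
have /= := @eq_free_linear K (X q) (fchain K X q) (chain_sh q \o restr g q)
  (restr g q \o chain_sh q); apply=> s.
by rewrite /= restr_single chain_sh_single restr_single chain_shZ chain_sh_single strat_sh.
Qed.

Lemma chain_pr_fbd q c : chain_pr q.-1 (fbd q c) = fbd q (chain_pr q c).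
Proof.
case: q c => [|q] c; first exact: linear0.
have /= := @eq_free_linear K (X q.+1) (fchain K Y q) (chain_pr q \o fbd q.+1)
  (fbd q.+1 \o chain_pr q.+1); apply=> s.
rewrite /= chain_pr_single !fbd_single chain_pr_sum; apply: eq_bigr => i _.
by rewrite chain_prZ chain_pr_single pr_facet.
Qed.

Lemma chain_sh_fbd q c : chain_sh q.-1 (fbd q c) = fbd q (chain_sh q c).
Proof.
case: q c => [|q] c; first exact: linear0.
have /= := @eq_free_linear K (X q.+1) (fchain K X q) (chain_sh q \o fbd q.+1)
  (fbd q.+1 \o chain_sh q.+1); apply=> s.
rewrite /= chain_sh_single !fbd_single chain_sh_sum; apply: eq_bigr => i _.
by rewrite chain_shZ chain_sh_single sh_facet.
Qed.

Lemma chain_pr_sh q c : chain_pr q (chain_sh q c) = chain_pr q c.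
Proof.
have /= := @eq_free_linear K (X q) (fchain K Y q) (chain_pr q \o chain_sh q)
  (chain_pr q); apply=> s.
by rewrite /= chain_sh_single !chain_pr_single pr_sh.
Qed.

(** If s and t have the same shift they lie in one orbit, and freeness forces the
    number of shifts between them to vanish. *)
Lemma sh_inj q : injective (@sh q).
Proof.
have aux (s t : X q) n : sh s = sh t -> t = iter n (@sh q) s -> s = t.
  move=> st tE; have : iter n (@sh q) (sh s) = sh s by rewrite -iterSr iterS -tE.
  by move=> /sh_free n0; rewrite tE n0.
move=> s t st; have prst : pr s = pr t by rewrite -(pr_sh s) st pr_sh.
have [n [|E]] := pr_fiber prst; first exact: aux.
by apply/esym; apply: aux E.
Qed.

Lemma coef_chain_sh q c s : coef (chain_sh q c) (sh s) = coef c s.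
Proof.
elim/free_ind: c => [|x y IHx IHy|k x IHx|t]; first by rewrite linear0 !coef0.
- by rewrite chain_shD !coefD IHx IHy.
- by rewrite chain_shZ !coefZ IHx.
- by rewrite chain_sh_single !coef_single (inj_eq (@sh_inj q)).
Qed.

(** A cell in the support of a fixed chain would have all its shifts, which are
    infinitely many, in the support. *)
Lemma chain_sh_fixed q c : chain_sh q c = c -> c = 0.
Proof.
move=> cE; apply: coefP => s; rewrite coef0; apply/eqP/negPn/negP => cs.
have csn n : coef c (iter n (@sh q) s) = coef c s.
  by elim: n => //= n <-; rewrite -[in LHS]cE coef_chain_sh.
apply: infinite_nat.
have -> : [set: nat] = (fun n => iter n (@sh q) s) @^-1` [set t | coef c t != 0].
  by apply/esym/seteqP; split => // n _ /=; rewrite csn.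
apply: finite_preimage; last exact: dsum_finite.
have le_inj m n : (m <= n)%N -> iter m (@sh q) s = iter n (@sh q) s -> m = n.
  move=> mn; rewrite -[in RHS](subnK mn) iterD => /esym/sh_free nm0.
  by apply/eqP; rewrite eqn_leq mn -subn_eq0 nm0.
move=> m n _ _ E; case/orP: (leq_total m n) => /le_inj; first exact.
by move=> /(_ (esym E)).
Qed.

(** Telescoping: 1 - sh divides 1 - sh^n. *)
Lemma iter_sh_boundary q n (s : X q) :
  exists y, single K (iter n (@sh q) s) - single K s = y - chain_sh q y.
Proof.
elim: n => [|n [y yE]]; first by exists 0; rewrite linear0 !subrr.
exists (y - single K (iter n (@sh q) s)).
by rewrite chain_shB chain_sh_single subrACA -yE subrACA subrr sub0r opprB.
Qed.

(** Choosing one cell in each orbit, a chain differs from the chosen lift of its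
    projection by elements of the image of 1 - sh. *)
Lemma chain_pr_ker q c : chain_pr q c = 0 -> exists y, c = y - chain_sh q y.
Proof.
pose sec (t : Y q) := sval (cid (@pr_surj q t)).
have secK t : pr (sec t) = t := svalP (cid (@pr_surj q t)).
pose lift := free_ext (fun t : Y q => single K (sec t) : fchain K X q).
suff [y yE] : exists y, c = lift (chain_pr q c) + (y - chain_sh q y).
  by move=> c0; exists y; rewrite {1}yE c0 linear0 add0r.
elim/free_ind: c => [|u v [y yE] [z zE]|k u [y yE]|s].
- by exists 0; rewrite !linear0 !addr0.
- exists (y + z); rewrite chain_prD chain_shD linearD opprD [y + z + _]addrACA.
  by rewrite [RHS]addrACA -yE -zE.
- exists (k *: y); rewrite chain_prZ linearZ_LR chain_shZ -scalerBr -scalerDr.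
  by rewrite -yE.
- rewrite chain_pr_single free_ext_single.
  have [n [sE|sE]] := pr_fiber (secK (pr s)).
    have [y yE] := iter_sh_boundary n (sec (pr s)).
    by exists y; rewrite -yE -sE addrC subrK.
  have [y yE] := iter_sh_boundary n s.
  by exists (- y); rewrite linearN -opprD -yE -sE opprB addrC subrK.
Qed.

Variable g : pred {set 'I_d}.
Hypothesis gC : convex g.

Let chain_pr_lift q (c : fchain K Y q) : restr g q c = c ->
  exists2 x, restr g q x = x & chain_pr q x = c.
Proof.
move=> gc; suff [x xc] : exists x, chain_pr q x = c.
  by exists (restr g q x); rewrite ?restr_id // chain_pr_restr xc.
elim/free_ind: {gc} c => [|u v [y yE] [z zE]|k u [y yE]|t].
- by exists 0; exact: linear0.
- by exists (y + z); rewrite chain_prD yE zE.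
- by exists (k *: y); rewrite chain_prZ yE.
- by have [s <-] := pr_surj t; exists (single K s); rewrite chain_pr_single.
Qed.

Let chain_pr_ker_restr q c : restr g q c = c -> chain_pr q c = 0 ->
  exists2 y, restr g q y = y & c = y - chain_sh q y.
Proof.
move=> gc /chain_pr_ker[y yE]; exists (restr g q y); first exact: restr_id.
by rewrite chain_sh_restr -restrB -yE.
Qed.

Let restr_fbd_sh q y : restr g q.-1 (fbd q (y - chain_sh q y)) =
  restr g q.-1 (fbd q y) - chain_sh q.-1 (restr g q.-1 (fbd q y)).
Proof. by rewrite fbdB restrB -chain_sh_fbd -chain_sh_restr. Qed.

(** The projection of a chain of X bounds as soon as the chain itself bounds up to
    the image of 1 - sh. *)
Let chain_pr_boundary q (x w : fchain K X q) (y : fchain K X q.+1) :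
  restr g _ y = y -> restr g _ (fbd _ y) = x - (w - chain_sh q w) ->
  is_boundary g (chain_pr q x).
Proof.
move=> gy yE; exists (chain_pr _ y); rewrite -chain_pr_restr gy; split => //.
by rewrite -(@chain_pr_fbd q.+1) -chain_pr_restr yE !chain_prB chain_pr_sh subrr subr0.
Qed.

Lemma covering_acyclic_at0 : acyclic_at K X g 0 -> acyclic_at K Y g 0.
Proof.
move=> X0 c [/chain_pr_lift[x gx <-] _]; have [|y [gy yE]] := X0 x.
  by split; last exact: linear0.
by apply: (@chain_pr_boundary _ x 0 y gy); rewrite linear0 !subr0.
Qed.

(** Lift a cycle to x; the boundary of x is w - sh w for some w, which is a cycle
    because 1 - sh is injective, hence is the boundary of some z.  Correcting x by
    z - sh z makes it a cycle of X. *)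
Lemma covering_acyclic_at q : acyclic_at K X g q -> acyclic_at K X g q.+1 ->
  acyclic_at K Y g q.+1.
Proof.
move=> Xq Xq1 c [/chain_pr_lift[x gx <-] c0].
have [||y gy yE] := @chain_pr_ker_restr q (restr g q (fbd q.+1 x)).
- exact: restr_id.
- by rewrite chain_pr_restr (@chain_pr_fbd q.+1).
have [|z [gz zE]] := Xq y.
  split=> //; apply: (@chain_sh_fixed q.-1).
  apply/eqP; rewrite eq_sym -subr_eq0 -restr_fbd_sh -yE.
  by rewrite (restr_fbd_fbd (c := x)).
have [|w [gw wE]] := Xq1 (x - (z - chain_sh _ z)).
  split; first by rewrite !restrB -chain_sh_restr gx gz.
  by rewrite fbdB restrB (@restr_fbd_sh q.+1) /= yE zE subrr.
exact: chain_pr_boundary wE.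
Qed.

(* From here on the chains of X resolve the scalars by the augmentation; g_up
   makes the augmentation vanish on boundaries. *)
Hypothesis g_up : forall I J : {set 'I_d}, I \subset J -> g I -> g J.
Variable v : X 0%N.
Hypothesis gv : g (strat v).
Hypothesis aug_boundary : forall c, restr g 0 c = c -> aug K X c = 0 ->
  is_boundary g c.

Let aug_restr_fbd (Z : faceSystem d) (y : fchain K Z 1) : restr g 1 y = y ->
  aug K Z (restr g 0 (fbd 1 y)) = 0.
Proof.
move=> gy; suff -> : restr g 0 (fbd 1 y) = fbd 1 y by exact: aug_fbd.
have := @eq_free_linear K (Z 1) (fchain K Z 0)
  (restr g 0 \o @fbd K d Z 1 \o restr g 1) (@fbd K d Z 1 \o restr g 1).
move=> /(_ _ y) /=; rewrite gy; apply=> s /=.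
rewrite restr_single !fbdZ restrZ; case gs: (g (strat s)); last by rewrite !scale0r.
rewrite restr_fbd_single fbd_single; congr (_ *: _); apply: eq_bigr => i _.
by rewrite (g_up (strat_facet s i) gs) scale1r.
Qed.

Let aug_pr c : aug K Y (chain_pr 0 c) = aug K X c.
Proof.
have /= := @eq_free_linear K (X 0) K^o (aug K Y \o chain_pr 0) (aug K X).
by apply=> s; rewrite /= chain_pr_single !aug_single.
Qed.

Let gv1 : restr g 0 (single K v) = single K v.
Proof. by rewrite restr_single gv scale1r. Qed.

(** The generator is the class of a vertex. *)
Lemma covering_line_at0 : line_at K Y g 0.
Proof.
exists (chain_pr 0 (single K v)); split.
- by split; [rewrite -chain_pr_restr gv1|exact: linear0].
- case=> y [gy yE]; have := aug_restr_fbd gy; rewrite yE aug_pr aug_single.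
  by move/eqP; rewrite oner_eq0.
- move=> c [/chain_pr_lift[x gx <-] _]; exists (aug K X x).
  have [||y [gy yE]] := @aug_boundary (x - aug K X x *: single K v).
  + by rewrite restrB restrZ gx gv1.
  + by rewrite linearB linearZ_LR /= aug_single [_ *: 1]mulr1 subrr.
  rewrite -chain_prZ -chain_prB.
  by apply: (@chain_pr_boundary _ _ 0 y gy); rewrite linear0 !subr0.
Qed.

(** The generator is the loop formed by an edge e of X from sh v to v.  If its
    image were a boundary, e would be a boundary up to some u - sh u, and v would
    equal the boundary of u, in contradiction with its augmentation. *)
Lemma covering_line_at1 : acyclic_at K X g 1 -> line_at K Y g 1.
Proof.
move=> X1.
have [||e [ge eE]] := @aug_boundary (single K v - chain_sh 0 (single K v)).
- by rewrite restrB -chain_sh_restr gv1.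
- by rewrite linearB /= chain_sh_single !aug_single subrr.
exists (chain_pr 1 e); split.
- split; first by rewrite -chain_pr_restr ge.
  by rewrite -(@chain_pr_fbd 1) -chain_pr_restr eE chain_prB chain_pr_sh subrr.
- case=> y [/chain_pr_lift[x gx <-]] yE.
  have [||u gu uE] := @chain_pr_ker_restr 1 (e - restr g 1 (fbd 2 x)).
  + by rewrite restrB ge restr_id.
  + by rewrite chain_prB chain_pr_restr (@chain_pr_fbd 2) yE subrr.
  have : single K v - restr g 0 (fbd 1 u) = 0.
    apply: (@chain_sh_fixed 0); apply/eqP; rewrite eq_sym -subr_eq0.
    rewrite chain_shB subrACA -eE -(@restr_fbd_sh 1 u) -uE fbdB restrB.
    by rewrite (restr_fbd_fbd (c := x)) //= subr0 subrr.
  move/(congr1 (aug K X)); rewrite linearB /= aug_single aug_restr_fbd // subr0 linear0.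
  by move/eqP; rewrite oner_eq0.
- move=> c [/chain_pr_lift[x gx <-] c0].
  have [||y gy yE] := @chain_pr_ker_restr 0 (restr g 0 (fbd 1 x)).
  + exact: restr_id.
  + by rewrite chain_pr_restr (@chain_pr_fbd 1).
  exists (aug K X y).
  have [||u [gu uE]] := @aug_boundary (y - aug K X y *: single K v).
  + by rewrite restrB restrZ gy gv1.
  + by rewrite linearB linearZ_LR /= aug_single [_ *: 1]mulr1 subrr.
  have [|w [gw wE]] := X1 (x - aug K X y *: e - (u - chain_sh 1 u)).
    split; first by rewrite !restrB restrZ -chain_sh_restr gx ge gu.
    rewrite fbdB restrB (@restr_fbd_sh 1) fbdB restrB fbdZ restrZ /= yE eE uE.
    by rewrite chain_shB chain_shZ scalerBr [X in X - _ = _]subrACA subrr.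
  rewrite -chain_prZ -chain_prB.
  exact: chain_pr_boundary wE.
Qed.

End Covering.

(** * Coordinates on exterior powers *)

Section ExteriorPower.
Variables (K : comNzRingType) (p : nat) (V : lmodType K).
Implicit Types (u : {ffun 'I_p -> V}) (W : lmodType K).

Lemma ext_ind (P : ext p V -> Prop) : P 0 ->
  (forall x y, P x -> P y -> P (x + y)) -> (forall k x, P x -> P (k *: x)) ->
  (forall u, P (wedge u)) -> forall x, P x.
Proof.
move=> P0 PD PZ Pw x; rewrite -[x]lquot_reprK; move: (lquot_repr x).
apply: (@free_ind K {ffun 'I_p -> V} (fun c => P (lquot_pi _ c))).
- by rewrite (linear0 (lquot_pi (@ext_rel K p V))).
- by move=> c e Pc Pe; rewrite (linearD (lquot_pi (@ext_rel K p V))); exact: PD.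
- by move=> k c Pc; rewrite (linearZ_LR (lquot_pi (@ext_rel K p V))); exact: PZ.
- exact: Pw.
Qed.

(** The universal property of the exterior power. *)
Section Lift.
Variables (W : lmodType K) (phi : {ffun 'I_p -> V} -> W).
Hypothesis phi_linear : forall u i (k : K) x y,
  phi (tuple_subst u i (k *: x + y)) =
  k *: phi (tuple_subst u i x) + phi (tuple_subst u i y).
Hypothesis phi_alt : forall u i j, i != j -> u i = u j -> phi u = 0.

Let lift : {linear free_tuples p V -> W} :=
  dsum_ext (fun u : {ffun 'I_p -> V} => scale_by (phi u)).
Let lift_gen u : lift (free_gen u) = phi u.
Proof. by rewrite [LHS]dsum_ext_in /= /scale_by scale1r. Qed.

Let lift_rel w : w \in Defs.span (@ext_rel K p V) -> lift w = 0.
Proof.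
move: w; apply: span_ker => w [[u [i [k [x [y ->]]]]]|[u [i [j [ij uij ->]]]]].
  by rewrite !linearB linearZ_LR !lift_gen phi_linear addrAC addrK subrr.
by rewrite lift_gen (phi_alt ij uij).
Qed.

Fact ext_lift_subproof :
  {f : {linear ext p V -> W} | forall u, f (wedge u) = phi u}.
Proof.
exists (lquot_lift lift_rel : {linear _ -> _}) => u.
by rewrite [LHS]lquot_liftE lift_gen.
Qed.
Definition ext_lift := sval ext_lift_subproof.
Lemma ext_liftE u : ext_lift (wedge u) = phi u.
Proof. exact: svalP ext_lift_subproof u. Qed.
End Lift.

Lemma tuple_subst_id (T : Type) (u : {ffun 'I_p -> T}) i : tuple_subst u i (u i) = u.
Proof. by apply/ffunP => j; rewrite !ffunE; case: eqP => [->|]. Qed.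

Definition wedge_at u i (x : V) : ext p V := wedge (tuple_subst u i x).
Fact wedge_at_is_linear u i : linear (wedge_at u i).
Proof. by move=> k x y; exact: wedge_linear. Qed.
HB.instance Definition _ u i :=
  GRing.isLinear.Build K V (ext p V) *:%R (wedge_at u i) (wedge_at_is_linear u i).

Lemma wedge_entry0 u i : u i = 0 -> wedge u = 0.
Proof.
by move=> ui; rewrite -(tuple_subst_id u i) ui -/(wedge_at u i 0) linear0.
Qed.

(** Polarization: expand the vanishing wedge with u i + u j at both places. *)
Lemma wedge_tperm u i j : i != j ->
  wedge [ffun k => u (tperm i j k)] = - wedge u.
Proof.
move=> ij; have ji : j != i by rewrite eq_sym.
pose w x y := wedge (tuple_subst (tuple_subst u i x) j y).
have wC x y : tuple_subst (tuple_subst u i x) j y = tuple_subst (tuple_subst u j y) i x.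
  apply/ffunP => k; rewrite !ffunE; have [->|] := eqVneq k j => //.
  by rewrite (negPf ji).
have wDr x y y' : w x (y + y') = w x y + w x y' by exact: (linearD (wedge_at _ j)).
have wDl x x' y : w (x + x') y = w x y + w x' y.
  by rewrite /w !wC; exact: (linearD (wedge_at _ i)).
have w0 x : w x x = 0.
  by apply: (@wedge_alt _ _ _ _ i j) => //; rewrite !ffunE !eqxx (negPf ij).
have wE : w (u i) (u j) = wedge u by rewrite /w !tuple_subst_id.
have wtE : w (u j) (u i) = wedge [ffun k => u (tperm i j k)].
  congr wedge; apply/ffunP => k; rewrite !ffunE; case: tpermP => [->|->|].
  - by rewrite eqxx (negPf ij).
  - by rewrite eqxx.
  - by move=> /eqP/negPf-> /eqP/negPf->.
apply/eqP; rewrite -addr_eq0 -wE -wtE; apply/eqP.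
by rewrite -(w0 (u i + u j)) wDr !wDl !w0 add0r addr0.
Qed.

Lemma wedge_perm u (s : 'S_p) :
  wedge [ffun k => u (s k)] = (-1) ^+ s *: wedge u.
Proof.
have [ts -> dts] := prod_tpermP s; elim: ts dts u => [_|t ts IH /= /andP[dt dts]] u.
  rewrite big_nil odd_perm1 scale1r; congr wedge.
  by apply/ffunP => k; rewrite ffunE perm1.
rewrite big_cons odd_mul_tperm dt addTb signrN scaleNr -scalerN.
rewrite scalerN -IH // -(wedge_tperm _ dt); congr wedge.
by apply/ffunP => k; rewrite !ffunE permM.
Qed.

End ExteriorPower.

Section Tangent.
Variables (K : comNzRingType) (d : nat).
Implicit Types I J : {set 'I_d}.

(** The vectors with j in I vanish; the others form a basis. *)
Definition tangent_basis I (j : 'I_d) : tangent K I :=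
  lquot_pi (@axes K d I) (delta_mx 0 j).

(* The factor (j \notin I) makes the coordinate total in j: it is the zero form
   when j is in I, as it must be on the quotient. *)
Section Coord.
Variables (I : {set 'I_d}) (j : 'I_d).

Let entry (v : 'rV[K]_d) : K^o := (j \notin I)%:R * v 0 j.
Fact entry_is_linear : linear entry.
Proof. by move=> k v w; rewrite /entry !mxE mulrDr mulrCA. Qed.
HB.instance Definition _ := GRing.isLinear.Build K 'rV[K]_d K^o *:%R entry entry_is_linear.

Fact entry_axes v : v \in Defs.span (@axes K d I) -> entry v = 0.
Proof.
move: v; apply: span_ker => _ [i iI ->]; rewrite /= /entry mxE eqxx /=.
by have [->|_] := eqVneq j i; rewrite ?iI ?mul0r ?mulr0.
Qed.

Fact tangent_coord_subproof : {f : {linear tangent K I -> K^o} |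
  forall v, f (lquot_pi _ v) = (j \notin I)%:R * v 0 j}.
Proof.
by exists (lquot_lift entry_axes : {linear lquot _ -> _}) => v; exact: lquot_liftE.
Qed.
Definition tangent_coord : {linear tangent K I -> K^o} := sval tangent_coord_subproof.
Lemma tangent_coord_pi v :
  tangent_coord (lquot_pi _ v) = (j \notin I)%:R * v 0 j.
Proof. exact: svalP tangent_coord_subproof v. Qed.

End Coord.

Lemma tangent_coord_basis I i j :
  tangent_coord I j (tangent_basis I i) = (j \notin I)%:R * (i == j)%:R.
Proof. by rewrite tangent_coord_pi mxE eqxx [j == i]eq_sym. Qed.

Lemma tangent_basis0 I j : j \in I -> tangent_basis I j = 0.
Proof.
move=> jI; rewrite -(linear0 (lquot_pi (@axes K d I))); apply/eqP.
by rewrite lquot_eq subr0; apply: mem_span; exists j.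
Qed.

Lemma tangent_span I v : exists c : 'I_d -> K, v = \sum_j c j *: tangent_basis I j.
Proof.
exists (fun j => lquot_repr v 0 j).
rewrite -[LHS]lquot_reprK {1}[lquot_repr v]row_sum_delta linear_sum.
by apply: eq_bigr => j _; rewrite linearZ.
Qed.

Lemma tangent_proj_basis I J (IJ : I \subset J) j :
  tangent_proj IJ (tangent_basis I j) = tangent_basis J j.
Proof. exact: lquot_liftE. Qed.

Lemma tangent_coord_proj I J (IJ : I \subset J) j v :
  tangent_coord J j (tangent_proj IJ v) = (j \notin J)%:R * tangent_coord I j v.
Proof.
rewrite -[v]lquot_reprK [tangent_proj _ _]lquot_liftE !tangent_coord_pi mulrA.
rewrite -natrM mulnb; case jJ : (j \in J) => //=.
by rewrite (contraFN _ jJ) // => /(fintype.subsetP IJ).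
Qed.

Variable p : nat.
Implicit Types f : {ffun 'I_p -> 'I_d}.

(** On the other strata both the minor on the columns f and the wedge of the
    basis vectors of indices f vanish. *)
Definition avoids f I := [forall k, f k \notin I].

Section Minor.
Variables (I : {set 'I_d}) (f : {ffun 'I_p -> 'I_d}).

Let minor_tuple (u : {ffun 'I_p -> tangent K I}) : K^o :=
  \det (\matrix_(i, k) tangent_coord I (f k) (u i)).

Let minor_tuple_linear u i (k : K) x y :
  minor_tuple (tuple_subst u i (k *: x + y)) =
  k *: minor_tuple (tuple_subst u i x) + minor_tuple (tuple_subst u i y).
Proof.
rewrite -[X in _ = _ + X]mul1r.
apply: (determinant_multilinear (i0 := i)).
- by apply/rowP => j; rewrite !mxE !ffunE eqxx linearP mul1r.
- by apply/matrixP => l j; rewrite !mxE !ffunE eq_sym (negPf (neq_lift _ _)).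
- by apply/matrixP => l j; rewrite !mxE !ffunE eq_sym (negPf (neq_lift _ _)).
Qed.

Let minor_tuple_alt (u : {ffun _ -> _}) (i j : 'I_p) : i != j -> u i = u j -> minor_tuple u = 0.
Proof.
by move=> ij uij; apply: (determinant_alternate ij) => k; rewrite !mxE uij.
Qed.

Definition minor : {linear multitangent K p I -> K^o} :=
  ext_lift minor_tuple_linear minor_tuple_alt.

Lemma minor_wedge u :
  minor (wedge u) = \det (\matrix_(i, k) tangent_coord I (f k) (u i)).
Proof. exact: ext_liftE. Qed.

Definition basis_wedge : multitangent K p I :=
  wedge [ffun i => tangent_basis I (f i)].

Lemma basis_wedge0 : ~~ avoids f I -> basis_wedge = 0.
Proof.
rewrite negb_forall => /existsP[k /negPn fk]; apply: (@wedge_entry0 _ _ _ _ k).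
by rewrite ffunE tangent_basis0.
Qed.

End Minor.

(** By multilinearity the entries of a wedge can be replaced with basis vectors
    one position at a time. *)
Lemma multitangent_ind I (P : multitangent K p I -> Prop) : P 0 ->
  (forall x y, P x -> P y -> P (x + y)) -> (forall k x, P x -> P (k *: x)) ->
  (forall f, P (basis_wedge I f)) -> forall x, P x.
Proof.
move=> P0 PD PZ Pb; apply: ext_ind => // u.
suff W n (w : {ffun 'I_p -> tangent K I}) :
    (forall i : 'I_p, (n <= i)%N -> exists j, w i = tangent_basis I j) -> P (wedge w).
  by apply: (W p) => i; rewrite leqNgt ltn_ord.
elim: n w => [|n IH] w wn.
  have {}wn i := cid (wn i isT).
  have -> : w = [ffun i => tangent_basis I ([ffun i => sval (wn i)] i)].
    by apply/ffunP => i; rewrite !ffunE; exact: svalP (wn i).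
  exact: Pb.
have [np|pn] := ltnP n p; last first.
  by apply: IH => i ni; have := ltn_ord i; rewrite ltnNge (leq_trans pn ni).
pose i0 := Ordinal np; have [c wE] := tangent_span (w i0).
rewrite -(tuple_subst_id w i0) wE -/(wedge_at w i0 _) linear_sum.
apply: big_ind => // j _; rewrite linearZ; apply/PZ/IH => i ni.
rewrite ffunE; have [_|ne] := eqVneq i i0; first by exists j.
by apply: wn; rewrite ltn_neqAle ni andbT eq_sym.
Qed.

(** The matrix has a zero column. *)
Lemma minor_hit I f x : ~~ avoids f I -> minor I f x = 0.
Proof.
rewrite negb_forall => /existsP[k /negPn fk]; move: x.
apply: ext_ind => [|x y fx fy|c x fx|u]; first exact: linear0.
- by rewrite linearD fx fy addr0.
- by rewrite linearZ fx; exact: scaler0.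
rewrite minor_wedge /determinant big1 // => s _.
rewrite (bigD1 ((s^-1)%g k)) //= mxE permKV.
suff tc0 v : tangent_coord I (f k) v = 0 by rewrite tc0 mul0r mulr0.
by rewrite -[v]lquot_reprK tangent_coord_pi fk mul0r.
Qed.

Lemma minor_proj I J (IJ : I \subset J) f (x : multitangent K p I) :
  minor J f (multitangent_proj IJ x) = (avoids f J)%:R * minor I f x.
Proof.
case fJ : (avoids f J); last by rewrite minor_hit ?fJ // mul0r.
rewrite mul1r; move: x; apply: ext_ind => [|x y fx fy|c x fx|u].
- by rewrite !linear0.
- by rewrite !linearD fx fy.
- by rewrite !linearZ /= fx.
rewrite [multitangent_proj _ _]ext_mapE !minor_wedge; congr (\det _).
apply/matrixP => i k; rewrite !mxE ffunE tangent_coord_proj.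
by rewrite (forallP fJ) mul1r.
Qed.

Lemma multitangent_proj_basis_wedge I J (IJ : I \subset J) f :
  multitangent_proj IJ (basis_wedge I f) = basis_wedge J f.
Proof.
rewrite [LHS]ext_mapE; congr wedge; apply/ffunP => i; rewrite !ffunE.
exact: tangent_proj_basis.
Qed.

Lemma basis_wedge_perm I f (s : 'S_p) :
  basis_wedge I [ffun i => f (s i)] = (-1) ^+ s *: basis_wedge I f.
Proof.
rewrite -wedge_perm; congr wedge; apply/ffunP => i.
by rewrite !ffunE.
Qed.

Lemma minor_basis_wedge I f f0 : avoids f0 I ->
  minor I f (basis_wedge I f0) =
  \sum_(s : 'S_p) (-1) ^+ s * ([ffun i => f (s i)] == f0)%:R.
Proof.
move=> f0I; rewrite minor_wedge; apply: eq_bigr => s _; congr (_ * _).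
have [fE|ne] := eqVneq.
  rewrite big1 // => i _; rewrite !mxE !ffunE tangent_coord_basis.
  have <- : f (s i) = f0 i by rewrite -fE ffunE.
  by rewrite eqxx -[f (s i)](ffunE (fun i => f (s i))) fE (forallP f0I) mulr1.
have [i fi] : exists i, f (s i) != f0 i.
  apply/existsP; apply: contraNT ne; rewrite negb_exists => /forallP fs.
  by apply/eqP/ffunP => i; rewrite ffunE; apply/eqP/negPn/fs.
rewrite (bigD1 i) //= !mxE ffunE tangent_coord_basis eq_sym (negPf fi).
by rewrite mulr0 mul0r.
Qed.

(** Each wedge of basis vectors is obtained once for every reordering of its
    factors, with the sign of the reordering on both the minor and the wedge.
    Summing over maps rather than over increasing ones avoids choosing
    representatives of the subsets, at the price of the factor p!. *)
Lemma sum_minor I x : \sum_f minor I f x *: basis_wedge I f = (p`!)%:R *: x.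
Proof.
move: x; apply: multitangent_ind => [|x y xE yE|k x xE|f0].
- by rewrite scaler0 big1 // => f _; rewrite linear0 scale0r.
- rewrite scalerDr -xE -yE -big_split; apply: eq_bigr => f _.
  by rewrite linearD scalerDl.
- rewrite scalerA mulrC -scalerA -xE scaler_sumr; apply: eq_bigr => f _.
  by rewrite linearZ scalerA.
case f0I : (avoids f0 I); last first.
  rewrite (basis_wedge0 (f := f0)) ?f0I // scaler0 big1 // => f _.
  by rewrite linear0 scale0r.
under eq_bigr do rewrite minor_basis_wedge // scaler_suml.
rewrite exchange_big /= (eq_bigr (fun=> basis_wedge I f0)) => [|s _].
  by rewrite sumr_const card_Sn scaler_nat.
rewrite (bigD1 [ffun i => f0 ((s^-1)%g i)]) //= big1 => [|f fne]; last first.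
  suff /negPf-> : [ffun i => f (s i)] != f0 by rewrite mulr0 scale0r.
  apply: contraNneq fne => <-; apply/eqP/ffunP => i.
  by rewrite !ffunE permKV.
rewrite addr0 (_ : _ == f0) ?mulr1; last first.
  by apply/eqP/ffunP => i; rewrite !ffunE permK.
by rewrite basis_wedge_perm scalerA odd_permV -expr2 sqrr_sign scale1r.
Qed.

Lemma basis_wedge_noninj I f : ~~ injectiveb f -> basis_wedge I f = 0.
Proof.
move=> /injectivePn[i [j ij fij]]; apply: (wedge_alt ij).
by rewrite !ffunE fij.
Qed.

(** The degrees p = 0 and p = d, where there is one set of p indices and a single
    minor is a coordinate. *)
Section TopDegree.
Variable f : {ffun 'I_p -> 'I_d}.
Hypothesis f_inj : injective f.
Hypothesis f_unique : forall f0 : {ffun 'I_p -> 'I_d}, injective f0 ->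
  exists s : 'S_p, f0 = [ffun i => f (s i)].

Lemma minor_self I : avoids f I -> minor I f (basis_wedge I f) = 1.
Proof.
move=> fI; rewrite minor_basis_wedge // (bigD1 1%g) //= odd_perm1 mul1r.
rewrite (_ : _ == f) ?addr0; last by apply/eqP/ffunP => i; rewrite ffunE perm1.
rewrite big1 ?addr0 // => s s1; case: eqP => [E|]; last by rewrite mulr0.
case/eqP: s1; apply/permP => i; rewrite perm1; apply: f_inj.
by move/ffunP: E => /(_ i); rewrite ffunE.
Qed.

Lemma minor_top I x : minor I f x *: basis_wedge I f = x.
Proof.
move: x; apply: multitangent_ind => [|x y xE yE|k x xE|f0].
- by rewrite linear0 scale0r.
- by rewrite linearD scalerDl xE yE.
- by rewrite linearZ -scalerA xE.
have [/injectiveP f0_inj|/basis_wedge_noninj->] := boolP (injectiveb f0); last first.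
  by rewrite linear0 scale0r.
have [s ->] := f_unique f0_inj; rewrite basis_wedge_perm linearZ -scalerA.
congr (_ *: _); case fI : (avoids f I); first by rewrite minor_self // scale1r.
by rewrite basis_wedge0 ?fI // scaler0.
Qed.

End TopDegree.

End Tangent.

(** * The cells of the Hopf manifold *)

Section CofaceIdentity.
Variables (R : realType) (q : nat).

Lemma std_simplexP n (t u : std_simplex R n) : (forall i, \val t 0 i = \val u 0 i) -> t = u.
Proof. by move=> tu; apply: val_inj; apply/rowP. Qed.

Lemma coface_coface (t : std_simplex R q) (i j : 'I_q.+2) : (i <= j)%N ->
  coface (lift ord0 j) (coface i t) = coface (inord i) (coface j t).
Proof.
move=> ij; have iv : (inord i : 'I_q.+3) = i :> nat by rewrite inordK // ltnS ltnW.
have liftij k : lift (lift ord0 j) (lift i k) = lift (inord i) (lift j k).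
  by apply: val_inj; rewrite /= iv /bump /=; repeat (case: leqP => /= ?); lia.
have Ej : lift ord0 j = lift (inord i) j :> 'I_q.+3.
  by apply: val_inj; rewrite /= iv /bump ij.
have Ei : lift (lift ord0 j) i = inord i :> 'I_q.+3.
  by apply: val_inj; rewrite /= iv /bump /=; repeat (case: leqP => /= ?); lia.
apply: std_simplexP => m /=; case: (unliftP (lift ord0 j) m) => [n|] ->.
  rewrite coface_mx_lift; case: (unliftP i n) => [k|] ->.
    by rewrite liftij !coface_mx_lift.
  by rewrite Ei !coface_mx_at.
by rewrite coface_mx_at Ej coface_mx_lift coface_mx_at.
Qed.

End CofaceIdentity.

Section HopfFaceSystem.
Variables (R : realType) (d : nat) (a : 'rV[R]_d).

Lemma simplexP q (s t : simplex a q) : (forall x, s x = t x) -> s = t.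
Proof.
case: s t => [s sc sa] [t tc ta] /= st; have {}st : s = t by exact/funext.
by case: _ / st tc ta => tc ta; congr Simplex; exact: Prop_irrelevance.
Qed.

Fact hopf_facet_facet q (s : simplex a q.+2) (i j : 'I_q.+2) : (i <= j)%N ->
  face (face s (lift ord0 j)) i = face (face s (inord i)) j.
Proof. by move=> ij; apply: simplexP => t /=; rewrite coface_coface. Qed.

Fact stratum_proper q (s : simplex a q) : stratum s != [set: 'I_d]%SET.
Proof.
rewrite /stratum; move: (s _) => x; apply/eqP => sT.
have := set_mem (valP (repr x : punctured R d)); apply/negP/negPn/eqP.
apply/rowP => i; rewrite mxE; apply/eqP.
by move/setP: sT => /(_ i); rewrite !inE.
Qed.

Definition hopfSystem : faceSystem d :=
  FaceSystem hopf_facet_facet (@stratum_face R d a) stratum_proper.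

End HopfFaceSystem.

(** * Homology of dimension zero and one *)

Section HomologyVanishing.
Variables (R : fieldType) (A B C : lmodType R).
Variables (f : {linear A -> B}) (g : {linear B -> C}).

(* To be applied to the boundaries, which already form a submodule. *)
Lemma span_sub (V : lmodType R) (G : set V) v : submod_set G -> v \in Defs.span G -> G v.
Proof. by move=> GP; rewrite inE; apply; split. Qed.

Lemma boundaries_submod : submod_set (@boundaries R A B C f g).
Proof.
split=> [|k u v [x xu] [y yv]]; first by exists 0; rewrite linear0.
by exists (k *: x + y); rewrite linearP xu yv.
Qed.

Lemma homology0 : (forall z, g z = 0 -> exists x, f x = z) ->
  forall h : homology f g, h = 0.
Proof.
move=> exact_fg h; rewrite -[h]lquot_reprK -(linear0 (lquot_pi _)).
apply/eqP; rewrite lquot_eq subr0; apply: mem_span.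
by have /eqP/exact_fg := valP (lquot_repr h).
Qed.

Lemma homology_line (z : B) : g z = 0 -> ~ (exists x, f x = z) ->
  (forall c, g c = 0 -> exists k x, f x = c - k *: z) ->
  lmod_iso (homology f g) R^o.
Proof.
move=> gz zb zP.
have zc : z \in Defs.cycle g by exact/eqP.
pose hz : homology f g := lquot_pi _ (Cycle zc).
have hz_free k : k *: hz = 0 -> k = 0.
  rewrite -linearZ -(linear0 (lquot_pi _)) => /eqP; rewrite lquot_eq subr0.
  move=> /(span_sub boundaries_submod)[x xE]; apply: contra_notP zb => /eqP k0.
  by exists (k^-1 *: x); rewrite linearZ xE /= scalerA mulVf // scale1r.
have hzP (h : homology f g) : exists k, h = k *: hz.
  have := valP (lquot_repr h) => /eqP /zP[k [x xE]]; exists k.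
  rewrite -[LHS]lquot_reprK -linearZ; apply/eqP; rewrite lquot_eq.
  by apply: mem_span; exists x.
pose phi h : R^o := sval (cid (hzP h)).
have phiE h : h = phi h *: hz := svalP (cid (hzP h)).
have hz_inj k l : k *: hz = l *: hz -> k = l.
  by move/eqP; rewrite -subr_eq0 -scalerBl => /eqP/hz_free/eqP; rewrite subr_eq0 => /eqP.
have phi_linear : linear phi.
  by move=> k x y; apply: hz_inj; rewrite scalerDl -scalerA -!phiE.
pose phiL := HB.pack phi (GRing.isLinear.Build R _ R^o *:%R phi phi_linear)
  : {linear homology f g -> R^o}.
exists phiL; exists (fun k : R^o => k *: hz) => x; first by rewrite -phiE.
by apply: hz_inj; rewrite -phiE.
Qed.

End HomologyVanishing.

(** * From tropical chains to free chains *)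

#[local] Arguments bd : simpl never.

Section Transfer.
Variables (R : realType) (d : nat) (a : 'rV[R]_d) (p : nat).
Local Notation X := (hopfSystem a).
Local Notation tchain := (chain a p).
Local Notation tsingle s := (@dsum_in _ _ (fun t => multitangent R p (stratum t)) s).

Lemma bd_tsingle q (s : simplex a q.+1) v : bd (q := q.+1) (tsingle s v) =
  \sum_(i < q.+2) (-1) ^+ i *: tsingle (face s i) (multitangent_proj (stratum_face s i) v).
Proof. exact: dsum_ext_in. Qed.

(** Each f gives a chain map from the tropical chains to the free chains on the
    strata avoided by f, and one backwards. *)
Section Minor.
Variable f : {ffun 'I_p -> 'I_d}.

Fact chain_minor_subproof q : {h : {linear tchain q -> fchain R X q} |
  forall s v, h (tsingle s v) = minor R (stratum s) f v *: single R s}.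
Proof.
pose phi (s : simplex a q) := (scale_by (single R s : fchain R X q) \o minor R (stratum s) f)
  : {linear multitangent R p (stratum s) -> fchain R X q}.
by exists (dsum_ext phi : {linear tchain q -> fchain R X q}) => s v; exact: dsum_ext_in.
Qed.
Definition chain_minor q := sval (chain_minor_subproof q).
Lemma chain_minor_tsingle q s v :
  chain_minor q (tsingle s v) = minor R (stratum s) f v *: single R s.
Proof. exact: svalP (chain_minor_subproof q) s v. Qed.

Definition chain_wedge q : {linear fchain R X q -> tchain q} :=
  free_ext (fun s : simplex a q => tsingle s (basis_wedge R (stratum s) f) : tchain q).
Lemma chain_wedge_single q (s : simplex a q) :
  chain_wedge q (single R s) = tsingle s (basis_wedge R (stratum s) f).
Proof. exact: free_ext_single. Qed.

Lemma chain_wedge0 q : chain_wedge q 0 = 0. Proof. exact: linear0. Qed.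
Lemma chain_wedgeD q x y : chain_wedge q (x + y) = chain_wedge q x + chain_wedge q y.
Proof. exact: linearD. Qed.
Lemma chain_wedgeB q x y : chain_wedge q (x - y) = chain_wedge q x - chain_wedge q y.
Proof. exact: linearB. Qed.
Lemma chain_wedgeZ q k x : chain_wedge q (k *: x) = k *: chain_wedge q x.
Proof. exact: linearZ. Qed.
Lemma chain_wedge_sum q n (F : 'I_n -> fchain R X q) :
  chain_wedge q (\sum_i F i) = \sum_i chain_wedge q (F i).
Proof. exact: linear_sum. Qed.

Lemma chain_minorD q x y : chain_minor q (x + y) = chain_minor q x + chain_minor q y.
Proof. exact: linearD. Qed.
Lemma chain_minorZ q k x : chain_minor q (k *: x) = k *: chain_minor q x.
Proof. exact: linearZ. Qed.
Lemma chain_minor0 q : chain_minor q 0 = 0. Proof. exact: linear0. Qed.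
Lemma chain_minor_sum q n (F : 'I_n -> tchain q) :
  chain_minor q (\sum_i F i) = \sum_i chain_minor q (F i).
Proof. exact: linear_sum. Qed.

Lemma chain_minor_restr q c : restr (avoids f) q (chain_minor q c) = chain_minor q c.
Proof.
elim/dsum_ind: c => [|x y xE yE|s v]; first by rewrite chain_minor0 restr0.
  by rewrite chain_minorD restrD xE yE.
rewrite chain_minor_tsingle restrZ restr_single; case fs : (avoids _ _).
  by rewrite scale1r.
by rewrite minor_hit ?fs // !scale0r.
Qed.

Lemma chain_minor_bd q c :
  chain_minor q.-1 (bd c) = restr (avoids f) q.-1 (fbd q (chain_minor q c)).
Proof.
case: q c => [|q] c; first by rewrite restr0 chain_minor0.
move: c; apply: dsum_ind => [|x y xE yE|s v].
- by rewrite linear0 !chain_minor0 fbd0 restr0.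
- by rewrite linearD !chain_minorD fbdD restrD xE yE.
rewrite bd_tsingle chain_minor_sum chain_minor_tsingle fbdZ restrZ restr_fbd_single.
rewrite scaler_sumr; apply: eq_bigr => i _.
rewrite chain_minorZ chain_minor_tsingle minor_proj !scalerA.
by congr (_ *: _); rewrite [LHS]mulrCA [LHS]mulrC; congr (_ * _); exact: mulrC.
Qed.

Lemma bd_chain_wedge q c : bd (chain_wedge q.+1 c) = chain_wedge q (fbd q.+1 c).
Proof.
have /= := @eq_free_linear R (X q.+1) (tchain q)
  (@bd R d a p q.+1 \o chain_wedge q.+1) (chain_wedge q \o @fbd R d X q.+1).
apply=> s; rewrite /= chain_wedge_single bd_tsingle fbd_single.
rewrite chain_wedge_sum; apply: eq_bigr => i _.
by rewrite chain_wedgeZ chain_wedge_single multitangent_proj_basis_wedge.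
Qed.

Lemma chain_wedge_restr q c : chain_wedge q (restr (avoids f) q c) = chain_wedge q c.
Proof.
have /= := @eq_free_linear R (X q) (tchain q)
  (chain_wedge q \o restr (avoids f) q) (chain_wedge q).
apply=> s; rewrite /= restr_single chain_wedgeZ chain_wedge_single.
case fs : (avoids _ _); first by rewrite scale1r.
by rewrite basis_wedge0 ?fs // [tsingle s _]linear0 scaler0.
Qed.

Lemma chain_wedge_noninj q c : ~~ injectiveb f -> chain_wedge q c = 0.
Proof.
move=> f_ninj.
have /= := @eq_free_linear R (X q) (tchain q) (chain_wedge q) \0.
apply=> s; rewrite chain_wedge_single basis_wedge_noninj //.
exact: (linear0 (@dsum_in _ _ (fun t => multitangent R p (stratum t)) s)).
Qed.

Lemma chain_minor_cycle q (c : tchain q) : bd c = 0 -> is_cycle (avoids f) (chain_minor q c).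
Proof.
by move=> c0; split; [exact: chain_minor_restr|rewrite -chain_minor_bd c0 chain_minor0].
Qed.

End Minor.

Lemma sum_chain_minor q (c : tchain q) :
  \sum_(f : {ffun 'I_p -> 'I_d}) chain_wedge f q (chain_minor f q c) = (p`!)%:R *: c.
Proof.
move: c; apply: dsum_ind => [|x y xE yE|s v].
- by rewrite scaler0 big1 // => f _; rewrite chain_minor0 chain_wedge0.
- rewrite scalerDr -xE -yE -big_split; apply: eq_bigr => f _.
  by rewrite chain_minorD chain_wedgeD.
rewrite -linearZ /= -sum_minor linear_sum; apply: eq_bigr => f _.
by rewrite chain_minor_tsingle chain_wedgeZ chain_wedge_single -linearZ.
Qed.

(** By [sum_chain_minor] a cycle is, up to p!, the sum of the images of its
    minors; each of them bounds when f is injective, and the image of any chain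
    is zero when f is not. *)
Lemma tropical_homology0 q :
  (forall f : {ffun 'I_p -> 'I_d}, injective f -> acyclic_at R X (avoids f) q) ->
  forall h : tropical_homology a p q, h = 0.
Proof.
move=> acyclic_f; apply: homology0 => z /= z0.
have fP f : exists x : tchain q.+1, bd x = chain_wedge f q (chain_minor f q z).
  have [/injectiveP f_inj|f_ninj] := boolP (injectiveb f); last first.
    by exists 0; rewrite linear0 chain_wedge_noninj.
  have [y [_ yE]] := acyclic_f f f_inj _ (chain_minor_cycle f z0).
  by exists (chain_wedge f _ y); rewrite bd_chain_wedge -chain_wedge_restr yE.
pose x f := sval (cid (fP f)).
have xE f : bd (x f) = chain_wedge f q (chain_minor f q z) := svalP (cid (fP f)).
exists ((p`!)%:R^-1 *: \sum_f x f).
have p0 : (p`!)%:R != 0 :> R by rewrite pnatr_eq0 -lt0n fact_gt0.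
rewrite linearZ_LR linear_sum /=; apply: (scalerI p0).
by rewrite scalerA mulfV // scale1r -sum_chain_minor; apply: eq_bigr => f _.
Qed.

Section TopDegree.
Variable f : {ffun 'I_p -> 'I_d}.
Hypothesis f_inj : injective f.
Hypothesis f_unique : forall f0 : {ffun 'I_p -> 'I_d}, injective f0 ->
  exists s : {perm 'I_p}, f0 = [ffun i => f (s i)].

Let minorK q c : chain_wedge f q (chain_minor f q c) = c.
Proof.
move: c; apply: dsum_ind => [|x y xE yE|s v].
- by rewrite chain_minor0 chain_wedge0.
- by rewrite chain_minorD chain_wedgeD xE yE.
rewrite chain_minor_tsingle chain_wedgeZ chain_wedge_single -linearZ /=.
by rewrite minor_top.
Qed.

Let wedgeK q c : chain_minor f q (chain_wedge f q c) = restr (avoids f) q c.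
Proof.
have /= := @eq_free_linear R (X q) (fchain R X q)
  (chain_minor f q \o chain_wedge f q) (restr (avoids f) q).
apply=> s; rewrite /= restr_single chain_wedge_single chain_minor_tsingle.
case fs : (avoids _ _); first by rewrite minor_self.
by rewrite basis_wedge0 ?fs // linear0.
Qed.

(** Here the two chain maps of f are inverse to each other. *)
Lemma tropical_homology_line q : line_at R X (avoids f) q ->
  lmod_iso (tropical_homology a p q) R^o.
Proof.
case=> z [zc zb zP]; apply: (homology_line (z := chain_wedge f q z)) => /=.
- case: q z zc {zb zP} => [//|q] z [gz z0].
  by rewrite bd_chain_wedge -chain_wedge_restr z0 chain_wedge0.
- case=> x xE; apply: zb; exists (chain_minor f _ x).
  split; first exact: chain_minor_restr.
  rewrite -(@chain_minor_bd f q.+1) /= [bd x]xE wedgeK.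
  by case: zc.
- move=> c /(chain_minor_cycle f)/zP[k [y [gy yE]]].
  exists k, (chain_wedge f _ y).
  rewrite bd_chain_wedge -chain_wedge_restr yE chain_wedgeB minorK.
  by rewrite chain_wedgeZ.
Qed.

End TopDegree.
End Transfer.

(** * Continuity and compactness *)

Section ContinuityTools.

Lemma cvg_row (T : Type) (F : set_system T) {FF : Filter F} (U : topologicalType) n
    (f : T -> 'rV[U]_n) (l : 'rV[U]_n) :
  (forall j, f x 0 j @[x --> F] --> l 0 j) -> f @ F --> l.
Proof.
move=> fl A /= [P Pl PA]; rewrite /nbhs /=.
have : F [set x | forall j, P 0 j (f x 0 j)].
  apply: (@filter_forall _ _ (fun j => [set x | P 0 j (f x 0 j)])) => j.
  by apply: (fl j); exact: Pl.
by apply: filterS => x Px; apply: PA => i j; rewrite (ord1 i).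
Qed.

Lemma cvg_entry (T : Type) (F : set_system T) {FF : Filter F} (U : topologicalType) n
    (f : T -> 'rV[U]_n) (l : 'rV[U]_n) j :
  f @ F --> l -> f x 0 j @[x --> F] --> l 0 j.
Proof.
move=> fl A lA; apply: (fl [set w | A (w 0 j)]).
exists (fun _ k => [set u | k = j -> A u]) => [i k|w /= /(_ 0 j)]; last exact.
rewrite (ord1 i); have [->|kj] := eqVneq k j; first by apply: filterS _ lA => u Au.
by apply: filterE => u /eqP; rewrite (negPf kj).
Qed.

Lemma cvg_sumr (R : realType) (T : Type) (F : set_system T) {FF : Filter F} n
    (f : 'I_n -> T -> R) (l : 'I_n -> R) :
  (forall i, f i @ F --> l i) -> \sum_i f i x @[x --> F] --> \sum_i l i.
Proof.
elim: n f l => [|n IH] f l fl.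
  by rewrite big_ord0; under eq_fun do rewrite big_ord0; exact: cvg_cst.
rewrite big_ord_recr; under eq_fun do rewrite big_ord_recr.
by apply: cvgD; [apply: IH => i|]; exact: fl.
Qed.

Lemma continuous_subbase (T : topologicalType) (R : realType) (f : T -> trop R) :
  (forall U, @trop_subbase R U -> open (f @^-1` U)) -> continuous f.
Proof.
move=> fU; apply/continuousP => _ [D DP <-]; rewrite preimage_bigcup.
apply: bigcup_open => A /DP[E EP <-]; rewrite preimage_bigcap.
rewrite openE => x Ex; apply: filter_bigI => U UE.
by apply: open_nbhs_nbhs; split; [exact/fU/set_mem/EP|exact: Ex].
Qed.

Lemma continuous_set_type (T U : topologicalType) (A : set U) (f : T -> A) :
  continuous (fun x => \val (f x)) -> continuous f.
Proof. exact: continuous_comp_initial. Qed.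

Lemma val_continuous (U : topologicalType) (A : set U) : continuous (fun x : A => \val x).
Proof. exact: initial_continuous. Qed.

Lemma compact_set_type (U : topologicalType) (A : set U) :
  compact A -> compact [set: A].
Proof.
move=> cA F PF _; have [|p [Ap clp]] := cA (fmap (fun x : A => \val x) F) _.
  by rewrite /fmap /=; apply: filterS (@filterT _ F _) => x _; exact: (set_mem (valP x)).
exists (exist _ p (mem_set Ap)); split=> // P Q FP.
case=> _ [[W oW <-] /= Wp] WQ.
have [_ [[x Px <-] Wx]] : (fun x : A => \val x) @` P `&` W !=set0.
  apply: clp; last exact: open_nbhs_nbhs.
  by rewrite /fmap /=; apply: filterS FP => x Px /=; exists x.
by exists x; split => //; exact: WQ.
Qed.

(* The norm of a row vector is the largest absolute value of its entries. *)
Lemma row_norm_le (R : realType) n (v : 'rV[R]_n) M :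
  0 <= M -> (forall j, `|v 0 j| <= M) -> `|v| <= M.
Proof.
move=> M0 vM; rewrite [leLHS]/Num.norm /= mx_normrE; apply/bigmax_leP; split=> //.
by move=> [i j] _; rewrite /= (ord1 i).
Qed.

End ContinuityTools.

Section StdSimplex.
Variables (R : realType) (q : nat).
Local Notation Delta := (std_simplex R q).

Lemma std_ge0 (t : Delta) i : 0 <= \val t 0 i.
Proof. by have /set_mem[] := valP t. Qed.

Lemma std_sum (t : Delta) : \sum_i \val t 0 i = 1.
Proof. by have /set_mem[] := valP t. Qed.

Lemma std_le1 (t : Delta) i : \val t 0 i <= 1.
Proof.
rewrite -(std_sum t) (bigD1 i) //= lerDl sumr_ge0 // => j _; exact: std_ge0.
Qed.

Lemma std_simplex_compact : compact [set: Delta].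
Proof.
apply/compact_set_type/bounded_closed_compact.
  exists 1; split; first exact: num_real.
  move=> M M1 t tS /=; apply: le_trans (ltW M1).
  apply: row_norm_le => // j; rewrite ger0_norm; last by case: tS.
  exact: (@std_le1 (exist _ t (mem_set tS))).
rewrite (_ : std_simplex R q = (\bigcap_(i in [set: 'I_q.+1]) [set t : 'rV_q.+1 | 0 <= t 0 i])
    `&` [set t : 'rV_q.+1 | \sum_i t 0 i = 1]); last first.
  apply/seteqP; split => t /= [t0 t1]; split => //.
    by move=> i _; exact: t0.
  by move=> i; exact: (t0 i I).
apply: closedI.
  apply: closed_bigI => i _.
  apply: (@closed_comp _ _ (fun t : 'rV[R]_q.+1 => t 0 i) [set x | 0 <= x]).
    by move=> t _; exact: coord_continuous.
  exact: closed_ge.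
apply: (@closed_comp _ _ (fun t : 'rV[R]_q.+1 => \sum_i t 0 i) [set x | x = 1]).
  by move=> t _; apply: (@cvg_sumr _ _ _ (nbhs_filter t)) => i; exact: coord_continuous.
exact: closed_eq.
Qed.

(** Existence of a Lebesgue number, by compactness of the simplex. *)
Lemma simplex_uniform (Q : Delta -> Delta -> Prop) :
  (forall t0 : Delta, exists2 U : set Delta, nbhs t0 U & forall t u, U t -> U u -> Q t u) ->
  exists2 e : R, 0 < e & forall t u : Delta, `|\val t - \val u| < e -> Q t u.
Proof.
move=> locQ.
have /compact_near_coveringP/(_ _ (0 : R)^'+
  (fun e t => forall u : Delta, `|\val t - \val u| < e -> Q t u)) := std_simplex_compact.
case=> [t0 _|r /= r0 rP].
  have [U /nbhs_ballP[r /= r0 rU] UQ] := locQ t0.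
  have r2 : 0 < r / 2 by rewrite divr_gt0.
  exists (ball t0 (r / 2), [set e | e < r / 2]) => /=.
    by split; [exact: nbhsx_ballx|exact: nbhs_right_lt].
  move=> [t e] /= [tB er] u tu; apply: UQ; apply: rU.
    by apply: le_ball tB; lra.
  rewrite (splitr r); apply: ball_triangle tB _.
  rewrite -initial_ballE /= -ball_normE /=; exact: lt_trans tu er.
exists (r / 2); first by rewrite divr_gt0.
move=> t u; apply: (rP (r / 2)) => //=; last by rewrite divr_gt0.
by rewrite sub0r normrN gtr0_norm ?divr_gt0 // ltr_pdivrMr // ltr_pMr // ltr1n.
Qed.

End StdSimplex.

(** * The orthant as a cover of the Hopf manifold *)

Section TropicalCoordinate.
Variables (R : realType) (b : R).
Hypothesis b_gt0 : 0 < b.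

(** The inverse of the coordinate [of_trop] on nonnegative numbers.  Sending all
    negative numbers to infinity keeps it continuous on the whole line. *)
Definition to_trop (u : R) : trop R := if 0 < u then Some (- b * ln u) else None.
Definition of_trop (x : trop R) : R := if x is Some r then expR (- r / b) else 0.

Lemma of_trop_ge0 x : 0 <= of_trop x.
Proof. by case: x => //= r; exact: expR_ge0. Qed.

Lemma of_trop_eq0 x : (of_trop x == 0) = (x == None).
Proof. by case: x => [r|] /=; rewrite ?eqxx // expR_eq0. Qed.

Lemma to_tropK u : 0 <= u -> of_trop (to_trop u) = u.
Proof.
rewrite /to_trop le_eqVlt => /predU1P[<-|u0]; first by rewrite ltxx.
have b0 : b != 0 by rewrite gt_eqF.
have bln : - (- b * ln u) / b = ln u by field.
by rewrite u0 /= bln lnK.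
Qed.

Lemma of_tropK x : to_trop (of_trop x) = x.
Proof.
have b0 : b != 0 by rewrite gt_eqF.
case: x => [r|] /=; rewrite /to_trop ?ltxx // expR_gt0 expRK; congr Some.
by field.
Qed.

Lemma to_trop_eq_None u : 0 <= u -> (to_trop u == None) = (u == 0).
Proof. by move=> u0; rewrite -of_trop_eq0 to_tropK. Qed.

Lemma of_trop_shift (x : trop R) (n : int) :
  of_trop (omap (fun r => r + (b *~ n)) x) = expR (- n%:~R) * of_trop x.
Proof.
case: x => [r|] /=; last by rewrite mulr0.
rewrite -expRD; congr expR; rewrite -mulrzr; field.
by rewrite gt_eqF.
Qed.

Lemma to_trop_continuous : continuous to_trop.
Proof.
apply: continuous_subbase => U [[V oV ->]|[c ->]].
  rewrite openE => u /= [r Vr]; rewrite /to_trop; case: ifP => // u0 [rE].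
  have cf : {for u, continuous (fun u => - b * ln u)}.
    by apply: cvgMl_tmp; exact: continuous_ln.
  have : nbhs u (fun u => V (- b * ln u)).
    by apply: cf; rewrite -rE; exact: open_nbhs_nbhs.
  move=> Vu; near=> w; exists (- b * ln w); first by near: w.
  by rewrite ifT //; near: w; exact: lt_nbhsr.
rewrite (_ : _ @^-1` _ = [set u | u < expR (- c / b)]); first exact: open_lt.
have aux u : 0 < u -> (c < - b * ln u) = (u < expR (- c / b)).
  move=> u0; rewrite -[u in RHS]lnK // ltr_expR ltr_pdivlMr //.
  by apply/idP/idP; lra.
apply/seteqP; split => u; rewrite /= /to_trop.
  case: ltP => [u0|u0 _]; first by rewrite aux.
  exact: le_lt_trans u0 (expR_gt0 _).
by move=> uc; case: (ltP 0 u) => // u0; rewrite aux.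
Unshelve. all: by end_near.
Qed.

Lemma of_trop_continuous : continuous of_trop.
Proof.
case=> [r|].
  move=> A /= Ar; have cf : {for r, continuous (fun r : R => expR (- r / b))}.
    apply: continuous_comp; last exact: continuous_expR.
    by apply: cvgMr_tmp; apply: cvgN; exact: cvg_id.
  have [V [oV Vr] VA] : exists2 V : set R, open_nbhs r V & forall s, V s -> A (expR (- s / b)).
    have := cf A Ar; rewrite nbhsE => -[V ? VA]; exists V => // s /VA; exact.
  have : nbhs (Some r : trop R) (Some @` V).
    apply: open_nbhs_nbhs; split; last by exists r.
    by apply: trop_subbase_open; left; exists V.
  move=> VS; apply: (@filterS _ (nbhs (Some r : trop R)) _ _ _ _ VS).
  by move=> _ [s Vs <-]; exact: VA.
apply/(cvgrPdist_lt (FF := nbhs_filter (None : trop R))) => e e0.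
have Ne : nbhs (None : trop R) [set x : trop R | if x is Some s then - b * ln e < s else True].
  apply: open_nbhs_nbhs; split => //; apply: trop_subbase_open; right.
  by exists (- b * ln e).
apply: (@filterS _ (nbhs (None : trop R)) _ _ _ _ Ne) => -[s|] /=; last by rewrite subrr normr0.
move=> es; rewrite sub0r normrN ger0_norm ?expR_ge0 //.
rewrite -[ltRHS]lnK ?posrE // ltr_expR ltr_pdivrMr //.
by rewrite ltrNl mulrC -mulNr.
Qed.

End TropicalCoordinate.

Section OrthantCoordinates.
Variables (R : realType) (d : nat) (a : 'rV[R]_d).
Hypothesis a_gt0 : forall i, 0 < a 0 i.

Definition orthant (w : 'rV[R]_d) : Prop := (forall i, 0 <= w 0 i) /\ w != 0.

Definition zeros (w : 'rV[R]_d) : {set 'I_d} := [set i | w 0 i == 0]%SET.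

(** Homogeneous, continuous and positive on X: its logarithm records the position
    of a point in its orbit. *)
Definition total (w : 'rV[R]_d) : R := \sum_i w 0 i.

Lemma total_gt0 w : orthant w -> 0 < total w.
Proof.
case=> w0 wn0; rewrite lt_neqAle sumr_ge0 ?andbT //.
apply: contra wn0; rewrite eq_sym /total psumr_eq0 // => /allP w00.
by apply/eqP/rowP => i; rewrite mxE; apply/eqP/w00; rewrite mem_index_enum.
Qed.

Lemma totalZ k w : total (k *: w) = k * total w.
Proof. by rewrite /total mulr_sumr; apply: eq_bigr => i _; rewrite mxE. Qed.

Lemma total_continuous : continuous total.
Proof. by move=> w; apply: (@cvg_sumr _ _ _ (nbhs_filter w)) => i; exact: coord_continuous. Qed.

Lemma orthantZ k w : 0 < k -> orthant w -> orthant (k *: w).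
Proof.
move=> k0 [w0 wn0]; split=> [i|]; first by rewrite mxE mulr_ge0 // ltW.
by rewrite scaler_eq0 negb_or wn0 gt_eqF.
Qed.

Lemma zerosZ k w : 0 < k -> zeros (k *: w) = zeros w.
Proof.
by move=> k0; apply/setP => i; rewrite !inE mxE mulf_eq0 gt_eqF.
Qed.

Definition of_trop_row (x : 'rV[trop R]_d) : 'rV[R]_d :=
  \row_i of_trop (a 0 i) (x 0 i).
Definition to_trop_row (w : 'rV[R]_d) : 'rV[trop R]_d :=
  \row_i to_trop (a 0 i) (w 0 i).

Lemma of_trop_rowK x : to_trop_row (of_trop_row x) = x.
Proof. by apply/rowP => i; rewrite !mxE of_tropK. Qed.

Lemma to_trop_rowK w : orthant w -> of_trop_row (to_trop_row w) = w.
Proof. by case=> w0 _; apply/rowP => i; rewrite !mxE to_tropK. Qed.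

Lemma of_trop_row_orthant (x : punctured R d) : orthant (of_trop_row (\val x)).
Proof.
split=> [i|]; first by rewrite mxE of_trop_ge0.
apply: contra (set_mem (valP x)) => /eqP x0; apply/eqP/rowP => i; rewrite mxE.
by apply/eqP; rewrite -(of_trop_eq0 (a 0 i)); move/rowP: x0 => /(_ i); rewrite !mxE => ->.
Qed.

Lemma to_trop_row_punctured w : orthant w -> to_trop_row w \in punctured R d.
Proof.
case=> w0 wn0; apply/mem_set; apply: contra wn0 => /eqP wE.
apply/eqP/rowP => i; rewrite mxE; apply/eqP; rewrite -(to_trop_eq_None (a_gt0 i)) //.
by move/rowP: wE => /(_ i); rewrite !mxE => ->.
Qed.

Lemma of_trop_row_shift x (n : int) :
  of_trop_row (trop_shift (a *~ n) x) = expR (- n%:~R) *: of_trop_row x.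
Proof.
have mulmz k : (a *~ n) 0 k = a 0 k *~ n by rewrite -scaler_int mxE mulrzl.
by apply/rowP => i; rewrite !mxE -of_trop_shift // mulmz.
Qed.

Lemma of_trop_row_continuous : continuous of_trop_row.
Proof.
move=> x; apply: (@cvg_row _ _ (nbhs_filter x)) => j; rewrite mxE; under eq_fun do rewrite mxE.
apply: (@cvg_comp _ _ _ (fun y : 'rV[trop R]_d => y 0 j) (of_trop (a 0 j))).
  by apply: (@cvg_entry _ _ (nbhs_filter x)); exact: cvg_id.
exact: of_trop_continuous.
Qed.

Lemma to_trop_row_continuous : continuous to_trop_row.
Proof.
move=> x; apply: (@cvg_row _ _ (nbhs_filter x)) => j; rewrite mxE; under eq_fun do rewrite mxE.
apply: (@cvg_comp _ _ _ (fun y : 'rV[R]_d => y 0 j) (to_trop (a 0 j))).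
  by apply: (@cvg_entry _ _ (nbhs_filter x)); exact: cvg_id.
exact: to_trop_continuous.
Qed.

Definition orthant_point w (w_in : orthant w) : punctured R d :=
  exist _ (to_trop_row w) (to_trop_row_punctured w_in).

Definition orthant_pi w (w_in : orthant w) : hopf a := hopf_pi a (orthant_point w_in).

Definition orthant_repr (x : hopf a) : 'rV[R]_d :=
  of_trop_row (\val (repr x : punctured R d)).

Lemma orthant_repr_in x : orthant (orthant_repr x).
Proof. exact: of_trop_row_orthant. Qed.

Lemma hopf_pi_eq (x y : punctured R d) :
  hopf_pi a x = hopf_pi a y <->
  exists n : int, of_trop_row (\val y) = expR n%:~R *: of_trop_row (\val x).
Proof.
split=> [/(@eqmodP _ (hopf_equivRel a)) /asboolP[n yx]|[n yx]].
  by exists (- n); rewrite yx of_trop_row_shift mulrNz.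
apply/(@eqmodP _ (hopf_equivRel a))/asboolP; exists (- n).
rewrite -[LHS]of_trop_rowK -[RHS]of_trop_rowK yx of_trop_row_shift.
by rewrite mulrNz opprK.
Qed.

Lemma orthant_pi_eq w w' (w_in : orthant w) (w'_in : orthant w') :
  orthant_pi w_in = orthant_pi w'_in <-> exists n : int, w' = expR n%:~R *: w.
Proof. by rewrite hopf_pi_eq /= !to_trop_rowK. Qed.

Lemma orthant_reprK x : orthant_pi (orthant_repr_in x) = x.
Proof.
rewrite -[RHS]reprK; apply/hopf_pi_eq; exists 0.
by rewrite /= to_trop_rowK ?expR0 ?scale1r //; exact: orthant_repr_in.
Qed.

Lemma sedentarity_orthant_pi w (w_in : orthant w) :
  sedentarity (orthant_pi w_in) = zeros w.
Proof.
rewrite sedentarity_pi; apply/setP => i; rewrite !inE mxE.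
by rewrite to_trop_eq_None //; case: w_in.
Qed.

Lemma orthant_pi_continuous (T : topologicalType) (s : T -> 'rV[R]_d)
    (s_in : forall t, orthant (s t)) :
  continuous s -> continuous (fun t => orthant_pi (s_in t)).
Proof.
move=> cs t.
apply: (@continuous_comp _ _ _ (fun t => orthant_point (s_in t)) (hopf_pi a)).
  apply: continuous_set_type => {}t /=.
  apply: (@continuous_comp _ _ _ s to_trop_row); first exact: cs.
  exact: to_trop_row_continuous.
exact: pi_continuous.
Qed.

(** The projection of X to S is open. *)
Lemma orbit_meets_open (W : set 'rV[R]_d) : open W ->
  open [set x : hopf a | exists n : int, W (expR n%:~R *: orthant_repr x)].
Proof.
move=> oW; rewrite /open /= /quotient_open.
rewrite (_ : _ @^-1` _ = \bigcup_(n in [set: int])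
    (fun x : punctured R d => expR n%:~R *: of_trop_row (\val x)) @^-1` W); last first.
  apply/seteqP; split => x /=.
    move=> [n Wn]; have [m xE] : exists m : int,
        orthant_repr (hopf_pi a x) = expR m%:~R *: of_trop_row (\val x).
      by apply/hopf_pi_eq; rewrite [RHS]reprK.
    exists (n + m) => //=; rewrite xE scalerA -expRD -intrD in Wn.
    exact: Wn.
  move=> [n _ /= Wn]; have [m xE] : exists m : int,
      of_trop_row (\val x) = expR m%:~R *: orthant_repr (hopf_pi a x).
    by apply/hopf_pi_eq; rewrite [LHS]reprK.
  by exists (n + m); rewrite xE scalerA -expRD -intrD in Wn.
apply: bigcup_open => n _; apply: open_comp => // x _.
have cf : {for x, continuous (fun x : punctured R d => of_trop_row (\val x))}.
  apply: (@continuous_comp _ _ _ (fun x : punctured R d => \val x) of_trop_row).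
    exact: val_continuous.
  exact: of_trop_row_continuous.
exact: (cvgZl_tmp cf).
Qed.

End OrthantCoordinates.

(** * Lifting simplices *)

Section SimplexPaths.
Variables (R : realType) (q : nat).
Local Notation Delta := (std_simplex R q).

(* The barycenter is a default value outside of the simplex. *)
Definition std_point (v : 'rV[R]_q.+1) : Delta :=
  if pselect (v \in std_simplex R q) is left v_in then exist _ v v_in
  else barycenter R q.

Lemma std_pointK v : v \in std_simplex R q -> \val (std_point v) = v.
Proof. by rewrite /std_point => v_in; case: pselect. Qed.

Definition toward (b t : Delta) (r : R) : Delta :=
  std_point (\val b + r *: (\val t - \val b)).

Lemma towardE b t r : 0 <= r <= 1 ->
  \val (toward b t r) = \val b + r *: (\val t - \val b).
Proof.
move=> /andP[r0 r1]; apply: std_pointK; apply/mem_set.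
have E i : (\val b + r *: (\val t - \val b)) 0 i = (1 - r) * \val b 0 i + r * \val t 0 i.
  by rewrite !mxE; ring.
split=> [i|].
  by rewrite E addr_ge0 // mulr_ge0 ?std_ge0 // subr_ge0.
under eq_bigr do rewrite E.
by rewrite big_split -!mulr_sumr /= !std_sum !mulr1 subrK.
Qed.

Lemma toward0 b t : toward b t 0 = b.
Proof. by apply: val_inj; rewrite towardE ?lexx ?ler01 // scale0r addr0. Qed.

Lemma toward1 b t : toward b t 1 = t.
Proof. by apply: val_inj; rewrite towardE ?lexx ?ler01 // scale1r addrC subrK. Qed.

Lemma toward_continuous b r : 0 <= r <= 1 -> continuous (fun t => toward b t r).
Proof.
move=> r01; apply: continuous_set_type.
under eq_fun do rewrite towardE //.
have cg : continuous (fun v : 'rV[R]_q.+1 => \val b + r *: (v - \val b)).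
  move=> v; have cB : (w - \val b) @[w --> v] --> v - \val b.
    exact: (cvgB cvg_id (cvg_cst _)).
  exact: (cvgD (cvg_cst (\val b)) (cvgZl_tmp cB)).
move=> t; apply: (@continuous_comp _ _ _ (fun t : Delta => \val t)
  (fun v : 'rV[R]_q.+1 => \val b + r *: (v - \val b))); last exact: cg.
exact: val_continuous.
Qed.

Lemma toward_steps (e : R) : 0 < e -> exists2 N, (0 < N)%N &
  forall b t k, (k < N)%N ->
    `|\val (toward b t (k%:R / N%:R)) - \val (toward b t (k.+1%:R / N%:R))| < e.
Proof.
move=> e0; pose N := (Num.truncn e^-1).+1; exists N => // b t k kN.
have N0 : 0 < N%:R :> R by rewrite ltr0n.
have kN1 j : (j <= N)%N -> 0 <= j%:R / (N%:R : R) <= 1.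
  by move=> jN; rewrite divr_ge0 //= ler_pdivrMr // mul1r ler_nat.
rewrite !towardE; [|exact: kN1|by apply: kN1; exact: ltnW].
rewrite opprD addrACA subrr add0r -scalerBl -mulrBl.
rewrite -natr1 opprD addrA subrr add0r mulN1r normrZ normrN gtr0_norm ?invr_gt0 //.
have tb : `|\val t - \val b| <= 1.
  apply: row_norm_le => // j; rewrite !mxE ler_norml.
  have := std_ge0 t j; have := std_ge0 b j; have := std_le1 t j; have := std_le1 b j.
  by move=> *; apply/andP; split; lra.
apply: (@le_lt_trans _ _ N%:R^-1).
  by rewrite ler_piMr // invr_ge0 ltW.
by rewrite invf_plt ?posrE //; exact: truncnS_gt.
Qed.

Lemma simplex_locally_constant (T : Type) (h : Delta -> T) :
  (forall t0 : Delta, \forall t \near t0, h t = h t0) -> forall b t, h b = h t.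
Proof.
move=> loc; have [|e e0 hP] := @simplex_uniform R q (fun t u => h t = h u).
  move=> t0; exists [set t | h t = h t0]; first exact: loc.
  by move=> t u /= -> ->.
move=> b t; have [N N0 NP] := toward_steps e0.
have hk k : (k <= N)%N -> h b = h (toward b t (k%:R / N%:R)).
  elim: k => [|k IH] kN; first by rewrite mul0r toward0.
  by rewrite IH; [exact/hP/NP|exact: ltnW].
by rewrite (hk N) // mulfV ?toward1 // pnatr_eq0 -lt0n.
Qed.

End SimplexPaths.

Section Lifting.
Variable R : realType.

(** The representative of y modulo the integers in [-1/2, 1/2[. *)
Definition signed_frac (y : R) : R := y - (Num.floor (y + 1 / 2))%:~R.

Lemma signed_frac_near y (n : int) : `|y - n%:~R| < 1 / 2 -> signed_frac y = y - n%:~R.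
Proof.
rewrite ltr_norml => /andP[yn ny]; congr (_ - _%:~R).
by apply: floor_def; rewrite intrD; apply/andP; split; lra.
Qed.

Variable q : nat.
Local Notation Delta := (std_simplex R q).

(** A map to the circle R/Z, given by a possibly discontinuous f with values in R,
    lifts to a continuous h.  Subdivide the segment from the barycenter to t into
    N steps, with N so large that f moves by less than 1/4 modulo integers at each
    step; the lift adds up the small representatives of these moves. *)
Lemma lift_mod_int (f : Delta -> R) :
  (forall t0 e, 0 < e -> \forall t \near t0, exists n : int, `|f t - f t0 - n%:~R| < e) ->
  exists2 h : Delta -> R, continuous h & forall t, exists n : int, h t = f t + n%:~R.
Proof.
move=> loc.
have [|e e0 eP] := @simplex_uniform R q
    (fun t u => exists n : int, `|f u - f t - n%:~R| < 1 / 4).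
  move=> t0; exists [set t | exists n : int, `|f t - f t0 - n%:~R| < 1 / 8].
    by apply: loc; rewrite divr_gt0.
  move=> t u [n tn] [m um]; exists (m - n); move: tn um.
  by rewrite intrB !ltr_norml => /andP[? ?] /andP[? ?]; apply/andP; split; lra.
have [N N0 NP] := toward_steps q e0; pose b := barycenter R q.
have NR : N%:R != 0 :> R by rewrite pnatr_eq0 -lt0n.
pose c k t := toward b t (k%:R / N%:R).
pose step k t := f (c k.+1 t) - f (c k t).
have stepP (k : 'I_N) t : exists n : int, `|step k t - n%:~R| < 1 / 4.
  exact/eP/NP.
exists (fun t => f b + \sum_(k < N) signed_frac (step k t)) => [t0|t]; last first.
  have stepZ k : exists n : int, signed_frac (step k t) = step k t + n%:~R.
    by exists (- Num.floor (step k t + 1 / 2)); rewrite intrN.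
  pose n k := sval (cid (stepZ k)); exists (\sum_(k < N) n k).
  rewrite (eq_bigr (fun k : 'I_N => step k t + (n k)%:~R)); last first.
    by move=> k _; exact: svalP (cid (stepZ k)).
  rewrite big_split /= -rmorph_sum addrA; congr (_ + _).
  rewrite -(big_mkord xpredT (fun k => step k t)) telescope_sumr //.
  by rewrite /c mul0r toward0 mulfV // toward1 addrC subrK.
suff cs (k : 'I_N) : signed_frac (step k t) @[t --> t0] --> signed_frac (step k t0).
  have := @cvg_sumr R _ _ (nbhs_filter t0) N
    (fun k t => signed_frac (step k t)) (fun k => signed_frac (step k t0)) cs.
  exact: (cvgD (cvg_cst (f b))).
apply/(cvgrPdist_lt (FF := nbhs_filter t0)) => r r0.
(* The step at t0 is within 1/4 of an integer.  An error below 1/4, modulo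
   integers, leaves the step at t within 1/2 of one, so that its small
   representative moves by that error only. *)
pose r' := Num.min r (1 / 4); have r'0 : 0 < r' by rewrite lt_min r0 divr_gt0.
have r'2 : 0 < r' / 2 by rewrite divr_gt0.
have near_c j : (j <= N)%N ->
    \forall t \near t0, exists n : int, `|f (c j t) - f (c j t0) - n%:~R| < r' / 2.
  move=> jN; have j01 : 0 <= j%:R / (N%:R : R) <= 1.
    by rewrite divr_ge0 //= ler_pdivrMr ?ltr0n // mul1r ler_nat.
  exact: (toward_continuous j01 (loc (c j t0) _ r'2)).
have c1 := near_c _ (ltnW (ltn_ord k)); have c2 := near_c _ (ltn_ord k).
apply: (filterS2 _ _ c1 c2) => t [n nP] [m mP].
have [n0 n0P] := stepP k t0.
have r'r : r' <= r by rewrite ge_min lexx.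
have r'4 : r' <= 1 / 4 by rewrite ge_min lexx orbT.
move: nP mP n0P; rewrite /step !ltr_norml => /andP[? ?] /andP[? ?] /andP[? ?].
rewrite (@signed_frac_near _ n0) ?(@signed_frac_near _ (n0 + m - n)).
- by rewrite intrB intrD; apply/andP; split; lra.
- by rewrite intrB intrD ltr_norml; apply/andP; split; lra.
- by rewrite ltr_norml; apply/andP; split; lra.
Qed.

End Lifting.

(** * The cells of the orthant *)

Section OrthantSimplices.
Variables (R : realType) (d : nat).

Record osimplex q := OSimplex {
  osimplex_fun :> std_simplex R q -> 'rV[R]_d;
  osimplex_continuous : continuous osimplex_fun;
  osimplex_orthant : forall t, orthant (osimplex_fun t);
  osimplex_admissible : forall K, exists I,
    forall t, open_face K t -> zeros (osimplex_fun t) = I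
}.
HB.instance Definition _ q := gen_eqMixin (osimplex q).
HB.instance Definition _ q := gen_choiceMixin (osimplex q).

Lemma osimplexP q (s t : osimplex q) : (forall x, s x = t x) -> s = t.
Proof.
case: s t => [s sc so sa] [t tc to ta] /= st; have {}st : s = t by exact/funext.
by case: _ / st tc to ta => tc to ta; congr OSimplex; exact: Prop_irrelevance.
Qed.

Fact oface_continuous q (s : osimplex q.+1) i : continuous (s \o coface i).
Proof.
move=> t; apply: continuous_comp; first exact: coface_continuous.
exact: osimplex_continuous.
Qed.

Fact oface_admissible q (s : osimplex q.+1) i K : exists I,
  forall t, open_face K t -> zeros ((s \o coface i) t) = I.
Proof.
have [I sI] := osimplex_admissible s (lift i @: K)%SET.
by exists I => t Kt; apply/sI/open_face_coface.
Qed.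

Definition oface q (s : osimplex q.+1) (i : 'I_q.+2) : osimplex q :=
  OSimplex (@oface_continuous q s i) (fun t => osimplex_orthant s (coface i t))
    (@oface_admissible q s i).

Definition ostratum q (s : osimplex q) : {set 'I_d} := zeros (s (barycenter R q)).

Lemma ostratumE q (s : osimplex q) t :
  open_face [set: 'I_q.+1]%SET t -> zeros (s t) = ostratum s.
Proof.
move=> t_in; have [I sI] := osimplex_admissible s [set: 'I_q.+1]%SET.
by rewrite /ostratum !sI //; exact: open_face_barycenter.
Qed.

Fact ostratum_proper q (s : osimplex q) : ostratum s != [set: 'I_d]%SET.
Proof.
have [_] := osimplex_orthant s (barycenter R q); apply: contra => /eqP sT.
apply/eqP/rowP => i; rewrite mxE; apply/eqP.
by move/setP: sT => /(_ i); rewrite !inE.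
Qed.

Section Projection.
Variable a : 'rV[R]_d.
Hypothesis a_gt0 : forall i, 0 < a 0 i.

Fact oproj_admissible q (s : osimplex q) :
  admissible (fun t => orthant_pi a_gt0 (osimplex_orthant s t)).
Proof.
move=> K; have [I sI] := osimplex_admissible s K; exists I => t Kt.
by rewrite sedentarity_orthant_pi sI.
Qed.

Definition oproj q (s : osimplex q) : simplex a q :=
  Simplex (@orthant_pi_continuous _ _ _ a_gt0 _ _ (osimplex_orthant s)
      (@osimplex_continuous _ s))
    (@oproj_admissible q s).

Lemma stratum_oproj q (s : osimplex q) : stratum (oproj s) = ostratum s.
Proof. exact: sedentarity_orthant_pi. Qed.

Lemma oproj_face q (s : osimplex q.+1) i : oproj (oface s i) = face (oproj s) i.
Proof. exact: simplexP. Qed.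

End Projection.

(** The projection to S for a = (1, ..., 1) reduces this to [stratum_face]. *)
Fact ostratum_face q (s : osimplex q.+1) i : ostratum s \subset ostratum (oface s i).
Proof.
have a_gt0 j : 0 < (const_mx 1 : 'rV[R]_d) 0 j by rewrite mxE.
by rewrite -!(stratum_oproj a_gt0) oproj_face stratum_face.
Qed.

Fact oface_oface q (s : osimplex q.+2) (i j : 'I_q.+2) : (i <= j)%N ->
  oface (oface s (lift ord0 j)) i = oface (oface s (inord i)) j.
Proof. by move=> ij; apply: osimplexP => t /=; rewrite coface_coface. Qed.

Definition orthantSystem : faceSystem d :=
  FaceSystem oface_oface ostratum_face ostratum_proper.

Section Scaling.
Variables (q : nat) (s : osimplex q).

Fact oscale_continuous : continuous (fun t => expR 1 *: s t).
Proof.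
move=> t; have cs : s u @[u --> t] --> s t by exact: osimplex_continuous.
exact: (cvgZl_tmp cs).
Qed.

Fact oscale_admissible K : exists I,
  forall t, open_face K t -> zeros (expR 1 *: s t) = I.
Proof.
have [I sI] := osimplex_admissible s K; exists I => t Kt.
by rewrite zerosZ ?expR_gt0 ?sI.
Qed.

Definition oscale : osimplex q :=
  OSimplex oscale_continuous
    (fun t => orthantZ (expR_gt0 1) (osimplex_orthant s t)) oscale_admissible.
End Scaling.

Lemma iter_oscale q n (s : osimplex q) t : iter n (@oscale q) s t = expR n%:R *: s t.
Proof.
elim: n => [|n IH]; first by rewrite expR0 scale1r.
by rewrite iterS /= IH scalerA -expRD nat1r.
Qed.

Lemma oscale_free q (s : osimplex q) n : iter n (@oscale q) s = s -> n = 0%N.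
Proof.
move=> /(congr1 (fun s : osimplex q => total (s (barycenter R q)))).
rewrite iter_oscale totalZ => /eqP; rewrite -[X in _ == X]mul1r.
rewrite (inj_eq (mulIf (lt0r_neq0 (total_gt0 (osimplex_orthant _ _))))).
by rewrite -[X in _ == X](@expR0 R) (inj_eq (@expR_inj R)) pnatr_eq0 => /eqP.
Qed.

Section Covering.
Variable a : 'rV[R]_d.
Hypothesis a_gt0 : forall i, 0 < a 0 i.

Lemma oproj_oscale q (s : osimplex q) : oproj a_gt0 (oscale s) = oproj a_gt0 s.
Proof.
apply: simplexP => t; apply/esym/orthant_pi_eq.
by exists 1.
Qed.

(** Two lifts differ at each point by an integer power of e, and the exponent is
    locally constant, as it is the logarithm of a continuous ratio. *)
Lemma oproj_fiber q (s t : osimplex q) : oproj a_gt0 s = oproj a_gt0 t ->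
  exists n, t = iter n (@oscale q) s \/ s = iter n (@oscale q) t.
Proof.
move=> st; have tsP x : exists n : int, t x = expR n%:~R *: s x.
  apply/(orthant_pi_eq a_gt0 (osimplex_orthant s x) (osimplex_orthant t x)).
  exact: (congr1 (fun s : simplex a q => s x) st).
pose m x := sval (cid (tsP x)); have mP x : t x = expR (m x)%:~R *: s x := svalP (cid (tsP x)).
pose ratio x := total (t x) / total (s x).
have s0 x : 0 < total (s x) by exact/total_gt0/osimplex_orthant.
have ratioE x : ratio x = expR (m x)%:~R.
  by rewrite /ratio mP totalZ mulfK // gt_eqF.
have total_cont (u : osimplex q) : continuous (fun x => total (u x)).
  move=> x; apply: (@continuous_comp _ _ _ u (@total R d)).
    exact: osimplex_continuous.
  exact: total_continuous.
have m_const x y : m x = m y.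
  apply: simplex_locally_constant => {}y.
  have ratio_cont : ratio x @[x --> y] --> ratio y.
    exact: (cvgM (total_cont t y) (cvgV (lt0r_neq0 (s0 y)) (total_cont s y))).
  pose V := [set z : R | expR ((m y)%:~R - 1) < z /\ z < expR ((m y)%:~R + 1)].
  have Vy : nbhs (ratio y) V.
    apply: open_nbhs_nbhs; split; first exact: (openI (@open_gt R _) (@open_lt R _)).
    by rewrite /V /= ratioE !ltr_expR; split; lra.
  apply: (@filterS _ (nbhs y) _ _ _ _ (ratio_cont _ Vy)) => z.
  rewrite /V /= ratioE !ltr_expR -[1]/(1%:~R) -intrB -intrD !ltr_int => -[? ?].
  by lia.
pose k := m (barycenter R q).
have tE x : t x = expR k%:~R *: s x by rewrite /k (m_const _ x) -mP.
exists `|k|%N; case: (intP k) tE => [|n|n] tE.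
- by left; apply: osimplexP => x; rewrite iter_oscale tE.
- by left; apply: osimplexP => x; rewrite iter_oscale tE.
- right; apply: osimplexP => x; rewrite iter_oscale tE scalerA -expRD.
  by rewrite mulrNz abszN absz_nat subrr expR0 scale1r.
Qed.

(** The logarithm f of [total] on arbitrary representatives is continuous modulo
    integers.  If h is a continuous lift of it, scaling each representative so
    that this logarithm becomes h selects a continuous lift of the simplex. *)
Lemma oproj_surj q (t : simplex a q) : exists s, oproj a_gt0 s = t.
Proof.
pose w x := orthant_repr (t x).
pose w_in x : orthant (w x) := orthant_repr_in (t x).
pose f x := ln (total (w x)).
have fE x : expR (f x) = total (w x) by rewrite lnK // posrE total_gt0.
have near_orbit (W : set 'rV[R]_d) x n : open W -> W (expR n%:~R *: w x) ->
    \forall y \near x, exists m : int, W (expR m%:~R *: w y).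
  move=> oW Wx; have oO := orbit_meets_open a_gt0 oW.
  have tO : nbhs (t x) [set z : hopf a | exists m : int, W (expR m%:~R *: orthant_repr z)].
    by apply: open_nbhs_nbhs; split; [exact: oO|exists n].
  exact: (simplex_continuous tO).
(* The points at logarithmic distance less than e from level c of [total]. *)
pose strip c e := [set v : 'rV[R]_d | expR (c - e) < total v /\ total v < expR (c + e)].
have strip_open c e : open (strip c e).
  apply: (@open_comp _ _ (@total R d) [set z | expR (c - e) < z /\ z < expR (c + e)]).
    by move=> v _; exact: total_continuous.
  exact: (openI (@open_gt R _) (@open_lt R _)).
have strip_orbit c e n x : strip c e (expR n%:~R *: w x) -> `|n%:~R + f x - c| < e.
  rewrite /strip /= totalZ -fE -expRD !ltr_expR => -[? ?].
  by rewrite ltr_norml; apply/andP; split; lra.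
have strip_center e n x : 0 < e -> strip (n%:~R + f x) e (expR n%:~R *: w x).
  by move=> e0; rewrite /strip /= totalZ -fE -expRD !ltr_expR; split; lra.
have [|h h_cont hP] := @lift_mod_int R q f.
  move=> x e e0; have := near_orbit _ x 0 (strip_open (0%:~R + f x) e) (strip_center _ _ _ e0).
  apply: filterS => y [n /strip_orbit]; rewrite add0r => ny.
  by exists (- n); rewrite intrN opprK addrC addrA.
pose s x := expR (h x - f x) *: w x.
have s_in x : orthant (s x) by apply: orthantZ => //; exact: expR_gt0.
have sE x n : h x = f x + n%:~R -> s x = expR n%:~R *: w x.
  by move=> hx; rewrite /s hx addrC addKr.
have s_cont : continuous s.
  move=> x A /=; rewrite nbhsE => -[W [oW Wx] WA].
  have [n hn] := hP x; have sx := sE x n hn.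
  (* Within a strip of half-width 1/2 around h, an orbit has at most one point,
     so the point of the orbit of y near s x is s y. *)
  have Wnear : \forall y \near x, exists m : int,
      (W `&` strip (h x) (1 / 2)) (expR m%:~R *: w y).
    apply: (near_orbit _ x n (openI oW (strip_open _ _))).
    by rewrite -sx; split => //; rewrite sx hn addrC; apply: strip_center; lra.
  have h_near : \forall y \near x, `|h x - h y| < 1 / 2.
    by have /cvgrPdist_lt := h_cont x; apply; lra.
  apply: (filterS2 _ _ Wnear h_near) => y [m [Wm /strip_orbit mh]] hxy.
  have [l hl] := hP y; have := WA _ Wm; suff <- : s y = expR m%:~R *: w y by [].
  rewrite (sE y l hl); congr (expR _%:~R *: _).
  move: mh hxy; rewrite hl !ltr_norml => /andP[? ?] /andP[? ?].
  have : (l - m)%:~R < (1%:~R : R) by rewrite intrB; lra.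
  have : (m - l)%:~R < (1%:~R : R) by rewrite intrB; lra.
  by rewrite !ltr_int; lia.
have s_adm K : exists I, forall x, open_face K x -> zeros (s x) = I.
  have [I tI] := simplex_admissible t K; exists I => x Kx.
  rewrite zerosZ ?expR_gt0 // -(tI x Kx) -(sedentarity_orthant_pi a_gt0 (w_in x)).
  by congr sedentarity; exact: orthant_reprK.
exists (OSimplex s_cont s_in s_adm); apply: simplexP => x /=.
rewrite -[RHS](orthant_reprK a_gt0); apply/orthant_pi_eq.
have [n hn] := hP x; exists (- n); rewrite (sE x n hn) scalerA -expRD.
by rewrite mulrNz addNr expR0 scale1r.
Qed.

End Covering.
End OrthantSimplices.

(** * Cones in the orthant *)

Section ConvexOrthant.
Variables (R : realType) (d : nat).
Implicit Types u v : 'rV[R]_d.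

Lemma orthant_convex u v r : orthant u -> orthant v -> 0 <= r <= 1 ->
  orthant (r *: u + (1 - r) *: v).
Proof.
move=> u_in v_in /andP[r0 r1]; have r1' : 0 <= 1 - r by rewrite subr_ge0.
have [u0 _] := u_in; have [v0 _] := v_in; split=> [i|].
  by rewrite !mxE addr_ge0 // mulr_ge0.
have tu := total_gt0 u_in; have tv := total_gt0 v_in.
suff : total (r *: u + (1 - r) *: v) != 0.
  apply: contraNneq => ->; by rewrite /total big1 // => i _; rewrite mxE.
rewrite gt_eqF // (_ : total _ = r * total u + (1 - r) * total v).
  by have [->|r_gt0] := eqVneq r 0; [lra|nra].
by rewrite -!totalZ /total -big_split; apply: eq_bigr => i _; rewrite mxE.
Qed.

Lemma zeros_convex u v r : orthant u -> orthant v -> 0 < r < 1 ->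
  zeros (r *: u + (1 - r) *: v) = (zeros u :&: zeros v)%SET.
Proof.
move=> [u0 _] [v0 _] /andP[r0 r1]; have r1' : 0 < 1 - r by rewrite subr_gt0.
apply/setP => i; rewrite !inE !mxE paddr_eq0 ?mulr_ge0 ?(ltW r0) ?(ltW r1') //.
by rewrite !mulf_eq0 (gt_eqF r0) (gt_eqF r1').
Qed.

End ConvexOrthant.

(** A point of the (q+1)-simplex other than the vertex 0 is on a segment from this
    vertex to a point of the opposite face, its tail. *)
Section Tail.
Variables (R : realType) (q : nat).
Implicit Types t : std_simplex R q.+1.

(** The barycentric coordinate at the vertex 0, to be mapped to the apex of a
    cone. *)
Definition apex t : R := \val t 0 ord0.

Definition tail t : std_simplex R q :=
  std_point (\row_j (\val t 0 (lift ord0 j) / (1 - apex t))).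

Lemma apex01 t : 0 <= apex t <= 1.
Proof. by rewrite std_ge0 std_le1. Qed.

Lemma apex_lt1 t : apex t != 1 -> 0 < 1 - apex t.
Proof. by move=> t1; rewrite subr_gt0 lt_neqAle t1 std_le1. Qed.

Lemma tail_sum t : \sum_j \val t 0 (lift ord0 j) = 1 - apex t.
Proof. by have := std_sum t; rewrite big_ord_recl => <-; rewrite /apex addrAC subrr add0r. Qed.

Lemma tailE t j : apex t != 1 -> \val (tail t) 0 j = \val t 0 (lift ord0 j) / (1 - apex t).
Proof.
move=> t1; have t1' := apex_lt1 t1; rewrite std_pointK ?mxE //.
apply/mem_set; split=> [i|]; first by rewrite mxE divr_ge0 ?std_ge0 // ltW.
under eq_bigr do rewrite mxE.
by rewrite -mulr_suml tail_sum mulfV // gt_eqF.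
Qed.

Lemma open_face_tail t (K : {set 'I_q.+2}) : apex t != 1 -> open_face K t ->
  open_face [set j | lift ord0 j \in K]%SET (tail t).
Proof.
move=> t1 Kt j; rewrite tailE // inE -(Kt (lift ord0 j)).
by rewrite pmulr_lgt0 // invr_gt0 apex_lt1.
Qed.

Lemma entry_continuous j : continuous (fun t => \val t 0 j).
Proof.
move=> t; apply: (@continuous_comp _ _ _ (fun t : std_simplex R q.+1 => \val t)
  (fun v : 'rV[R]_q.+2 => v 0 j)); first exact: val_continuous.
exact: coord_continuous.
Qed.

Lemma tail_continuous t : apex t != 1 -> tail @ t --> tail t.
Proof.
move=> t1 A /= [_ [[W oW <-] /= Wt] WA].
suff tail_cvg : \val (tail u) @[u --> t] --> \val (tail t).
  have tW := tail_cvg W (open_nbhs_nbhs (conj oW Wt)).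
  by apply: (@filterS _ (nbhs t) _ _ _ _ tW) => u; exact: WA.
apply: (@cvg_row _ _ (nbhs_filter t)) => j; rewrite tailE //.
have cvg_quot : (fun u : std_simplex R q.+1 =>
    \val u 0 (lift ord0 j) / (1 - apex u)) @ t -->
    \val t 0 (lift ord0 j) / (1 - apex t).
  apply: (cvgM (@entry_continuous _ t) (cvgV (lt0r_neq0 (apex_lt1 t1)) _)).
  exact: (cvgB (cvg_cst _) (@entry_continuous _ t)).
apply: cvg_trans cvg_quot; apply: near_eq_cvg.
have near_lt1 : nbhs (apex t) [set r | r < 1].
  by apply: open_nbhs_nbhs; split; [exact: open_lt|rewrite /= -subr_gt0 apex_lt1].
have u_lt1 := @entry_continuous ord0 t _ near_lt1.
by apply: (@filterS _ (nbhs t) _ _ _ _ u_lt1) => u /= u1; rewrite tailE // lt_eqF.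
Qed.

End Tail.

Section Cone.
Variables (R : realType) (d : nat) (b : 'rV[R]_d).
Hypothesis b_in : orthant b.

Section ConeSimplex.
Variables (q : nat) (s : osimplex R d q).

Definition cone_fun (t : std_simplex R q.+1) : 'rV[R]_d :=
  apex t *: b + (1 - apex t) *: s (tail t).

(* For the continuity of the cone at its apex. *)
Lemma osimplex_bounded : exists2 M, 0 < M & forall t, `|s t| <= M.
Proof.
have sc : continuous s by exact: osimplex_continuous.
have := compact_bounded (continuous_compact (continuous_subspaceT sc)
  (@std_simplex_compact R q)).
move=> [M [_ sM]]; exists (Num.max 1 (M + 1)); first by rewrite lt_max ltr01.
move=> t; apply: (sM (Num.max 1 (M + 1))); first by rewrite lt_max ltrDl ltr01 orbT.
by exists t.
Qed.

(** The tail is discontinuous at the vertex 0, but s is bounded by compactness and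
    is multiplied there by a factor that tends to zero. *)
Fact cone_continuous : continuous cone_fun.
Proof.
move=> t; have capex : apex u @[u --> t] --> apex t by exact: entry_continuous.
have capex1 : 1 - apex u @[u --> t] --> 1 - apex t.
  exact: (cvgB (cvg_cst _) capex).
suff c : (fun u => (1 - apex u) *: s (tail u)) @ t --> (1 - apex t) *: s (tail t).
  exact: (cvgD (cvgZr_tmp capex) c).
have [t1|t1] := eqVneq (apex t) 1; last first.
  have cs : s (tail u) @[u --> t] --> s (tail t).
    exact: (cvg_comp _ _ (tail_continuous t1) (@osimplex_continuous _ _ _ s _)).
  exact: (cvgZ capex1 cs).
rewrite t1 subrr scale0r; have [M M0 sM] := osimplex_bounded.
apply/(cvgrPdist_lt (FF := nbhs_filter t)) => e e0.
rewrite t1 subrr in capex1.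
have /cvgrPdist_lt/(_ (e / M)) := capex1; rewrite divr_gt0 // => /(_ isT).
apply: filterS => u; rewrite !sub0r !normrN ltr_pdivlMr // => ue.
by rewrite normrZ; apply: le_lt_trans ue; rewrite ler_wpM2l.
Qed.

Fact cone_orthant t : orthant (cone_fun t).
Proof. exact: orthant_convex (osimplex_orthant _ _) (apex01 t). Qed.

(** A face of the cone is a face of s, the apex, or the join of both; by
    positivity the vanishing coordinates of a join are those common to the two
    ends. *)
Fact cone_admissible K : exists I, forall t, open_face K t -> zeros (cone_fun t) = I.
Proof.
pose K' := [set j | lift ord0 j \in K]%SET.
have [I sI] := osimplex_admissible s K'.
exists (if ord0 \notin K then I else if K' == finset.set0 then zeros b else zeros b :&: I)%SET.
move=> t Kt; have K0 := Kt ord0; rewrite -/(apex t) in K0.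
case: ifP => [/negPf K0F|/negbFE K0T].
  have t0 : apex t = 0.
    by apply/eqP; rewrite eq_le std_ge0 leNgt K0 K0F.
  by rewrite /cone_fun t0 scale0r add0r subr0 scale1r sI //; apply: open_face_tail;
    rewrite ?t0 // eq_sym oner_eq0.
have tail_gt0 j : (0 < \val t 0 (lift ord0 j)) = (j \in K') by rewrite Kt inE.
case: eqP => [K'0|/eqP/set0Pn[j jK']].
  have t1 : apex t = 1.
    apply/esym/eqP; rewrite -subr_eq0 -tail_sum big1 // => j _.
    by apply/eqP; rewrite eq_le std_ge0 leNgt tail_gt0 K'0 inE.
  by rewrite /cone_fun t1 scale1r subrr scale0r addr0.
have t1 : apex t < 1.
  rewrite -subr_gt0 -tail_sum (bigD1 j) //= ltr_pwDl ?tail_gt0 //.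
  by apply: sumr_ge0 => k _; exact: std_ge0.
rewrite zeros_convex ?K0 ?K0T ?t1 //; last exact: osimplex_orthant.
by rewrite sI //; apply: open_face_tail => //; rewrite lt_eqF.
Qed.

Definition cone : osimplex R d q.+1 :=
  OSimplex cone_continuous cone_orthant cone_admissible.

Lemma ostratum_cone : ostratum cone = (zeros b :&: ostratum s)%SET.
Proof.
pose t := barycenter R q.+1; have tT := @open_face_barycenter R q.+1.
have t1 : 0 < apex t < 1.
  rewrite /apex /= mxE invr_gt0 ltr0n /= invf_lt1 ?ltr0n //.
  by rewrite ltr1n.
rewrite /ostratum /= zeros_convex //; last exact: osimplex_orthant.
congr (_ :&: _)%SET; apply: ostratumE.
have /open_face_tail/(_ tT) : apex t != 1 by case/andP: t1 => _ /lt_eqF->.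
by rewrite (_ : [set j | _]%SET = [set: 'I_q.+1]%SET) //; apply/setP => j; rewrite !inE.
Qed.

Lemma oface_cone0 : oface cone ord0 = s.
Proof.
apply: osimplexP => t /=; have t0 : apex (coface ord0 t) = 0 by rewrite /apex /= coface_mx_at.
rewrite /cone_fun t0 scale0r add0r subr0 scale1r; congr (s _).
apply: std_simplexP => j; rewrite tailE ?t0 ?subr0 ?divr1 /= ?coface_mx_lift //.
by rewrite eq_sym oner_eq0.
Qed.

End ConeSimplex.

Lemma oface_cone q (s : osimplex R d q.+1) i :
  oface (cone s) (lift ord0 i) = cone (oface s i).
Proof.
apply: osimplexP => t /=; have tE : apex (coface (lift ord0 i) t) = apex t.
  rewrite /apex /= (_ : ord0 = lift (lift ord0 i) ord0) ?coface_mx_lift //.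
  by apply: val_inj.
rewrite /cone_fun tE /=; have [->|t1] := eqVneq (apex t) 1.
  by rewrite subrr !scale0r.
congr (_ + _ *: s _); apply: std_simplexP => j; rewrite tailE tE //=.
case: (unliftP i j) => [k|] ->.
  rewrite coface_mx_lift tailE // (_ : lift ord0 (lift i k) = lift (lift ord0 i) (lift ord0 k)).
    by rewrite coface_mx_lift.
  by apply: val_inj; rewrite /= /bump /=; repeat (case: leqP => /= ?); lia.
by rewrite !coface_mx_at mul0r.
Qed.

Fact opoint_continuous : continuous (fun _ : std_simplex R 0 => b).
Proof. exact: cst_continuous. Qed.

Fact opoint_admissible (K : {set 'I_1}) : exists I,
  forall t : std_simplex R 0, open_face K t -> zeros b = I.
Proof. by exists (zeros b). Qed.

Definition opoint : osimplex R d 0 :=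
  OSimplex opoint_continuous (fun=> b_in) opoint_admissible.

Lemma oface_cone_point (s : osimplex R d 0) : oface (cone s) (lift ord0 ord0) = opoint.
Proof.
apply: osimplexP => t /=; have t1 : apex (coface (lift ord0 ord0) t) = 1.
  rewrite /apex /= (_ : ord0 = lift (lift ord0 ord0) ord0) ?coface_mx_lift; last by apply: val_inj.
  by rewrite -(std_sum t) big_ord1.
by rewrite /cone_fun t1 scale1r subrr scale0r addr0.
Qed.

End Cone.

(** * Homology of the orthant *)

(* Keep the cells of X folded, so that lemmas on face systems still apply. *)
#[local] Arguments orthantSystem : simpl never.
#[local] Arguments strat : simpl never.
#[local] Arguments facet : simpl never.
#[local] Arguments cell : simpl never.

Section Between.
Variable d : nat.
Implicit Types I J L : {set 'I_d}.

(** The chains on these strata are those of the closed face of L, relative to the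
    union of the facets of the elements of J. *)
Definition between L J : pred {set 'I_d} :=
  fun I => (L \subset I) && (I \subset (~: J)%SET).

Lemma between_convex L J : convex (between L J).
Proof.
move=> I I' I'' II' I'I'' /andP[LI _] /andP[_ I''J]; apply/andP; split.
  exact: fintype.subset_trans II'.
exact: fintype.subset_trans I''J.
Qed.

Lemma between_up L I I' :
  I \subset I' -> between L finset.set0 I -> between L finset.set0 I'.
Proof.
move=> II' /andP[LI _]; apply/andP; split; first exact: fintype.subset_trans II'.
by rewrite finset.setC0 finset.subsetT.
Qed.

End Between.

Section OrthantHomology.
Variables (R : realType) (d : nat) (L J : {set 'I_d}).
Hypothesis LJ : L \subset (~: J)%SET.
Hypothesis LJ_proper : (L :|: J)%SET != [set: 'I_d]%SET.
Local Notation X := (orthantSystem R d).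
Local Notation g := (between L J).

(* The apex of the cones. *)
Let b : 'rV[R]_d := \row_i (i \notin (L :|: J)%SET)%:R.

Let b_in : orthant b.
Proof.
split=> [i|]; first by rewrite mxE ler0n.
apply: contra LJ_proper => /eqP/rowP b0; apply/eqP/setP => i.
rewrite [RHS]inE; apply/negPn/negP => iLJ.
by move: (b0 i); rewrite !mxE iLJ => /eqP; rewrite oner_eq0.
Qed.

Let zeros_b : zeros b = (L :|: J)%SET.
Proof.
apply/setP => i; rewrite [LHS]inE mxE.
by case: (i \in _); rewrite /= ?eqxx ?oner_eq0.
Qed.

(** The cone on a simplex of stratum I has stratum (L u J) n I. *)
Let between_cone q (s : X q) : L \subset strat s ->
  g (strat (cone b_in s : X q.+1)) = g (strat s).
Proof.
move=> Ls; have -> : strat (cone b_in s : X q.+1) = ((L :|: J) :&: strat s)%SET.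
  by rewrite -zeros_b; exact: ostratum_cone.
rewrite /between Ls finset.subsetI finset.subsetUl Ls /=.
apply/fintype.subsetP/fintype.subsetP => H i iI.
  rewrite inE; apply/negP => iJ; suff /H : i \in ((L :|: J) :&: strat s)%SET.
    by rewrite inE iJ.
  by rewrite finset.in_setI iI finset.in_setU iJ orbT.
by apply: H; move: iI; rewrite finset.in_setI => /andP[].
Qed.

Definition chain_cone q : {linear fchain R X q -> fchain R X q.+1} :=
  free_ext (fun s : X q => single R (cone b_in s : X q.+1) : fchain R X q.+1).
Lemma chain_cone_single q s : chain_cone q (single R s) = single R (cone b_in s : X q.+1).
Proof. exact: free_ext_single. Qed.
Lemma chain_cone0 q : chain_cone q 0 = 0. Proof. exact: linear0. Qed.
Lemma chain_coneZ q k x : chain_cone q (k *: x) = k *: chain_cone q x.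
Proof. exact: linearZ. Qed.
Lemma chain_cone_sum q n (F : 'I_n -> fchain R X q) :
  chain_cone q (\sum_i F i) = \sum_i chain_cone q (F i).
Proof. exact: linear_sum. Qed.

(** The cone operator is a contracting homotopy. *)
Lemma fbd_chain_cone q (c : fchain R X q.+1) :
  fbd q.+2 (chain_cone q.+1 c) = c - chain_cone q (fbd q.+1 c).
Proof.
have := @eq_free_linear R (X q.+1) (fchain R X q.+1)
  (@fbd R d X q.+2 \o chain_cone q.+1) (idfun \- (chain_cone q \o @fbd R d X q.+1)).
apply=> s; rewrite /= chain_cone_single !fbd_single big_ord_recl expr0 scale1r.
congr (_ + _); first by congr single; exact: oface_cone0.
rewrite chain_cone_sum -sumrN; apply: eq_bigr => i _.
rewrite chain_coneZ chain_cone_single -scaleNr; congr (_ *: single R _).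
  by rewrite /= /bump /= add1n exprS mulN1r.
exact: oface_cone.
Qed.

Lemma fbd_chain_cone0 (c : fchain R X 0) :
  fbd 1 (chain_cone 0 c) = c - aug R X c *: single R (opoint b_in : X 0).
Proof.
pose point_part : {linear fchain R X 0 -> fchain R X 0} :=
  scale_by (single R (opoint b_in : X 0) : fchain R X 0) \o aug R X.
have := @eq_free_linear R (X 0) (fchain R X 0)
  (@fbd R d X 1 \o chain_cone 0) (idfun \- point_part).
apply=> s; rewrite /= chain_cone_single fbd_single big_ord_recl big_ord1 expr0 scale1r.
rewrite expr1 scaleN1r /scale_by /= aug_single scale1r.
congr (_ - _); first by congr single; exact: oface_cone0.
by congr single; exact: oface_cone_point.
Qed.

Lemma restr_chain_cone q (c : fchain R X q) :
  restr g q c = c -> restr g q.+1 (chain_cone q c) = chain_cone q c.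
Proof.
move=> gc; rewrite -gc.
have := @eq_free_linear R (X q) (fchain R X q.+1)
  (restr g q.+1 \o chain_cone q \o restr g q) (chain_cone q \o restr g q).
apply=> s; rewrite /= restr_single chain_coneZ chain_cone_single restrZ restr_single.
case gs : (g (strat s)); last by rewrite !scale0r.
by rewrite between_cone ?gs ?scale1r //; case/andP: gs.
Qed.

Lemma restr_chain_cone_fbd q (c : fchain R X q.+1) : restr g q.+1 c = c ->
  restr g q.+1 (chain_cone q (fbd q.+1 c)) = chain_cone q (restr g q (fbd q.+1 c)).
Proof.
move=> gc; rewrite -gc.
have := @eq_free_linear R (X q.+1) (fchain R X q.+1)
  (restr g q.+1 \o chain_cone q \o @fbd R d X q.+1 \o restr g q.+1)
  (chain_cone q \o restr g q \o @fbd R d X q.+1 \o restr g q.+1).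
apply=> s; rewrite /= restr_single !fbdZ !(chain_coneZ, restrZ).
case gs : (g (strat s)); last by rewrite !scale0r.
rewrite !scale1r restr_fbd_single fbd_single !chain_cone_sum restr_sum.
apply: eq_bigr => i _; rewrite !chain_coneZ restrZ chain_cone_single restr_single.
rewrite between_cone //; apply: fintype.subset_trans (strat_facet s i).
by case/andP: gs.
Qed.

Lemma orthant_acyclic_at q : acyclic_at R X g q.+1.
Proof.
move=> c [gc c0]; exists (chain_cone _ c); split; first exact: restr_chain_cone.
by rewrite fbd_chain_cone restrB restr_chain_cone_fbd // [restr g q _]c0 chain_cone0 subr0.
Qed.

Lemma orthant_aug_boundary (c : fchain R X 0) :
  restr g 0 c = c -> aug R X c = 0 -> is_boundary g c.
Proof.
move=> gc c0; exists (chain_cone _ c); split; first exact: restr_chain_cone.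
by rewrite fbd_chain_cone0 c0 scale0r subr0.
Qed.

(** The term with the apex in [fbd_chain_cone0] disappears, since the stratum of
    the apex meets J. *)
Lemma orthant_acyclic_at0 : J != finset.set0 -> acyclic_at R X g 0.
Proof.
move=> J0 c [gc _]; exists (chain_cone _ c); split; first exact: restr_chain_cone.
rewrite fbd_chain_cone0 restrB restrZ restr_single (_ : g (strat _) = false).
  by rewrite scale0r scaler0 subr0.
rewrite [strat _]zeros_b; apply/negbTE/negP => /andP[_].
rewrite finset.subUset => /andP[_ /fintype.subsetP JJ].
by have /set0Pn[i iJ] := J0; have := JJ i iJ; rewrite inE iJ.
Qed.

Lemma orthant_cell_between : J = finset.set0 -> exists v : X 0, g (strat v).
Proof.
move=> J0; exists (opoint b_in); rewrite [strat _]zeros_b J0 finset.setU0 /between subxx.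
by rewrite finset.setC0 finset.subsetT.
Qed.

End OrthantHomology.

(** * Homology of the Hopf manifold *)

Section HopfHomology.
Variables (R : realType) (d : nat) (a : 'rV[R]_d).
Hypothesis a_gt0 : forall i, 0 < a 0 i.
Local Notation S := (hopfSystem a).
Local Notation X := (orthantSystem R d).
Implicit Types L J : {set 'I_d}.

Let pr q (s : X q) : S q := oproj a_gt0 s.
Let sh q (s : X q) : X q := oscale s.
Let pr_facet q (s : X q.+1) i : pr (facet s i) = facet (pr s) i. Proof. exact: oproj_face. Qed.
Let sh_facet q (s : X q.+1) i : sh (facet s i) = facet (sh s) i. Proof. exact: osimplexP. Qed.
Let strat_pr q (s : X q) : strat (pr s) = strat s. Proof. exact: stratum_oproj. Qed.
Let strat_sh q (s : X q) : strat (sh s) = strat s.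
Proof. by apply: zerosZ; exact: expR_gt0. Qed.
Let pr_surj q (t : S q) : exists s, pr s = t. Proof. exact: oproj_surj. Qed.
Let pr_sh q (s : X q) : pr (sh s) = pr s. Proof. exact: oproj_oscale. Qed.
Let pr_fiber q (s t : X q) : pr s = pr t ->
  exists n, t = iter n (@sh q) s \/ s = iter n (@sh q) t.
Proof. exact: oproj_fiber. Qed.
Let sh_free q (s : X q) n : iter n (@sh q) s = s -> n = 0%N.
Proof. exact: oscale_free. Qed.

Lemma hopf_acyclic_at L J q : L \subset (~: J)%SET -> (L :|: J)%SET != [set: 'I_d]%SET ->
  (J != finset.set0) || (1 < q)%N -> acyclic_at R S (between L J) q.
Proof.
move=> LJ LJp; case: q => [|q].
  rewrite orbF => J0; apply: (covering_acyclic_at0 (X := X) (pr := pr) (sh := sh)) => //.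
  exact: orthant_acyclic_at0.
move=> H; apply: (covering_acyclic_at (X := X) (pr := pr) (sh := sh)) => //.
- exact: between_convex.
- case: q H => [|q] H; last exact: orthant_acyclic_at.
  by apply: orthant_acyclic_at0 => //; move: H; rewrite orbF.
- exact: orthant_acyclic_at.
Qed.

Lemma hopf_line_at L q : L != [set: 'I_d]%SET -> (q <= 1)%N ->
  line_at R S (between L finset.set0) q.
Proof.
move=> Lp q1; have L0 : L \subset (~: finset.set0)%SET by rewrite finset.setC0 finset.subsetT.
have L0p : (L :|: finset.set0)%SET != [set: 'I_d]%SET by rewrite finset.setU0.
have [v gv] := orthant_cell_between R L0p (erefl _).
case: q q1 => [|[|//]] _.
  apply: (covering_line_at0 pr_facet strat_pr pr_surj pr_sh _ gv).
    exact: between_up.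
  exact: orthant_aug_boundary.
apply: (covering_line_at1 pr_facet sh_facet strat_pr strat_sh pr_surj pr_sh pr_fiber
  sh_free _ _ gv).
- exact: between_convex.
- exact: between_up.
- exact: orthant_aug_boundary.
- exact: orthant_acyclic_at.
Qed.

(** If the stratum of a cell contains every index but j, it cannot contain j. *)
Lemma stratum_between j q (s : S q) :
  between (~: [set j])%SET finset.set0 (strat s) = between (~: [set j])%SET [set j]%SET (strat s).
Proof.
rewrite /between finset.setC0 finset.subsetT andbT.
apply/idP/andP => [Ls|[]//]; split => //.
apply/fintype.subsetP => i si; rewrite !inE; apply: contra (strat_proper s) => /eqP ij.
apply/eqP/setP => k; rewrite [RHS]inE; have [->|kj] := eqVneq k i; first by rewrite si.
by apply: (fintype.subsetP Ls); rewrite !inE -ij.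
Qed.

(** Induction on J, removing an index j: the strata between ~: J and ~: (J - j)
    split according to whether they contain j. *)
Lemma hopf_corner k J : #|J| = k.+1 ->
  (forall q, (k <= q <= k.+1)%N -> line_at R S (between (~: J)%SET J) q) /\
  (forall q, ~~ (k <= q <= k.+1)%N -> acyclic_at R S (between (~: J)%SET J) q).
Proof.
elim: k J => [|k IH] J Jk.
  have [j ->] : exists j, J = [set j]%SET by exact/cards1P/eqP.
  have Lp : (~: [set j])%SET != [set: 'I_d]%SET.
    by apply/eqP => /setP/(_ j); rewrite !inE eqxx.
  split=> q q1.
    apply: (@eq_line_at _ _ _ (between (~: [set j])%SET finset.set0)).
      by move=> r s; exact: stratum_between.
    exact: hopf_line_at.
  apply: (@eq_acyclic_at _ _ _ (between (~: [set j])%SET finset.set0)).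
    by move=> r s; exact: stratum_between.
  apply: hopf_acyclic_at; first by rewrite finset.setC0 finset.subsetT.
    by rewrite finset.setU0.
  by move: q1; rewrite leq0n /= -ltnNge => ->; rewrite orbT.
have [j jJ] : exists j, j \in J by apply/set0Pn; rewrite -card_gt0 Jk.
pose J' := (J :\ j)%SET.
have J'k : #|J'| = k.+1 by move: Jk; rewrite (cardsD1 j) jJ => -[].
have [IHline IHacyclic] := IH _ J'k.
have gC : convex (between (~: J)%SET J') by exact: between_convex.
have J'C : (~: J' = ~: J :|: [set j])%SET.
  by apply/setP => i; rewrite !inE negb_and negbK orbC.
have JC : (~: J = ~: J' :\ j)%SET.
  by apply/setP => i; rewrite !inE; case: eqP => [->|]; rewrite ?jJ.
have sub_between (I : {set 'I_d}) : between (~: J')%SET J' I =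
    between (~: J)%SET J' I && (j \in I).
  by rewrite /between J'C finset.subUset finset.sub1set -!andbA [(j \in I) && _]andbC.
have sub_between_out (I : {set 'I_d}) : between (~: J)%SET J I =
    between (~: J)%SET J' I && (j \notin I).
  by rewrite /between {2}JC finset.subsetD1 andbA.
have gE (I : {set 'I_d}) :
    between (~: J)%SET J' I = between (~: J')%SET J' I || between (~: J)%SET J I.
  by rewrite sub_between sub_between_out; case: between; case: (j \in I).
have g12 (I I' : {set 'I_d}) :
    I \subset I' -> between (~: J')%SET J' I -> ~~ between (~: J)%SET J I'.
  move=> II'; rewrite sub_between sub_between_out => /andP[_ jI].
  by rewrite (fintype.subsetP II' _ jI) andbF.
have g_acyclic q : acyclic_at R S (between (~: J)%SET J') q.
  apply: hopf_acyclic_at.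
  - by rewrite finset.setCS finset.subD1set.
  - apply/eqP => /setP/(_ j); rewrite !inE jJ eqxx //.
  - by rewrite -card_gt0 J'k.
split=> -[|q] qk //.
- exact: (line_at_quotient gC gE g12 g_acyclic (IHline q qk)).
- exact: (acyclic_at0_quotient gE g12 g_acyclic).
- exact: (acyclic_at_quotient gC gE g12 g_acyclic (IHacyclic q qk)).
Qed.

End HopfHomology.

Section AvoidedStrata.
Variables (d p : nat) (f : {ffun 'I_p -> 'I_d}).

Lemma avoids_between I : avoids f I = between finset.set0 (f @: 'I_p)%SET I.
Proof.
rewrite /between finset.sub0set; apply/forallP/fintype.subsetP => [fI i iI|If k].
  by rewrite inE; apply/imsetP => -[k _ ik]; have := fI k; rewrite -ik iI.
by apply/negP => /If; rewrite inE imset_f.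
Qed.

End AvoidedStrata.

Theorem proposition5p5 (R : realType) (d : nat) (a : 'rV[R]_d)
    (d_gt0 : (0 < d)%N) (a_gt0 : forall i, 0 < a 0 i) (p q : nat) :
  if (p, q) \in [:: (0, 0); (0, 1); (d, d.-1); (d, d)]%N
  then lmod_iso (tropical_homology a p q) R^o
  else forall x : tropical_homology a p q, x = 0.
Proof.
have set0_proper : finset.set0 != [set: 'I_d]%SET.
  by rewrite eq_sym -card_gt0 cardsT card_ord.
have cardT : #|[set: 'I_d]%SET| = d.-1.+1 by rewrite cardsT card_ord prednK.
have [line_d acyclic_d] := hopf_corner a_gt0 cardT.
rewrite !inE !xpair_eqE; case: ifPn => [pq|npq].
  have [[p0 q1]|[pd qd]] : p = 0%N /\ (q <= 1)%N \/ p = d /\ (d.-1 <= q <= d.-1.+1)%N.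
    by move: pq; lia.
  - subst p; pose f : {ffun 'I_0 -> 'I_d} := [ffun i => Ordinal d_gt0].
    apply: (@tropical_homology_line _ _ _ _ f); first by case.
      by move=> f0 _; exists 1%g; apply/ffunP => -[].
    apply: (@eq_line_at _ _ _ (between finset.set0 finset.set0)).
      move=> r s; rewrite avoids_between (_ : imset _ _ = finset.set0) //.
      by apply/setP => i; rewrite inE; apply/imsetP => -[[]].
    exact: hopf_line_at.
  - subst p; pose f : {ffun 'I_d -> 'I_d} := [ffun i => i].
    have f_inj : injective f by move=> i j; rewrite !ffunE.
    apply: (@tropical_homology_line _ _ _ _ f) => //.
      move=> f0 f0_inj; exists (perm f0_inj); apply/ffunP => i.
      by rewrite !ffunE permE.
    apply: eq_line_at (line_d q qd) => r s; rewrite avoids_between finset.setCT.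
    congr (between _ _ _); apply/esym/setP => i; rewrite inE.
    by apply/imsetP; exists i; rewrite ?ffunE.
apply: tropical_homology0 => f f_inj.
have f_card : #|(f @: 'I_p)%SET| = p by rewrite card_imset // card_ord.
have p_le : (p <= d)%N by rewrite -f_card -[leqRHS]card_ord max_card.
apply: (@eq_acyclic_at _ _ _ (between finset.set0 (f @: 'I_p)%SET)).
  by move=> r s; rewrite avoids_between.
have [pd|pd] := eqVneq p d.
  have fT : (f @: 'I_p)%SET = [set: 'I_d]%SET.
    by apply/eqP; rewrite finset.eqEcard finset.subsetT cardsT card_ord f_card pd leqnn.
  by rewrite fT -finset.setCT; apply: acyclic_d; move: npq; lia.
apply: hopf_acyclic_at => //.
- exact: finset.sub0set.
- rewrite finset.set0U; apply: contra pd => /eqP fT.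
  by rewrite -f_card fT cardsT card_ord.
- rewrite -card_gt0 f_card; move: npq pd p_le; lia.
Qed.
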